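(* Consider a two-node repeater $A-N_1-N_2-B$ in which segment $S_1=(A,N_1)$ shares $|\psi(\alpha'_l)\rangle=\sqrt{\alpha'_l}|00\rangle+\sqrt{1-\alpha'_l}|11\rangle$, segment $S_2=(N_1,N_2)$ shares $\rho(p,\delta)=p|01\rangle\langle01|+(1-p)|\zeta_\delta\rangle\langle\zeta_\delta|$ with $|\zeta_\delta\rangle=\sqrt\delta|00\rangle+\sqrt{1-\delta}|11\rangle$, and segment $S_3=(N_2,B)$ shares $|\psi(\alpha'_r)\rangle=\sqrt{\alpha'_r}|00\rangle+\sqrt{1-\alpha'_r}|11\rangle$, where $p\in(0,1)$, $\delta\in[1/2,1)$, $\alpha'_l,\alpha'_r\in[1/2,1)$. If $$\frac{\alpha'_l\alpha'_r}{(1-\alpha'_l)(1-\alpha'_r)}\le\frac{p^2}{\delta(1-\delta)(1-p)^2},$$ then the LOCC protocol in which $N_2$ and then $N_1$ each perform a Bell-basis measurement on their two qubits, followed by optimal two-party LOCC by $A$ and $B$ on each resulting conditional state, achieves average fully entangled fraction $F^\star(\rho(p,\delta))$; hence $F^\star_{AB}=F^\star(\rho(p,\delta))$.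
   Context: Bell basis: $(|00\rangle\pm|11\rangle)/\sqrt2$, $(|01\rangle\pm|10\rangle)/\sqrt2$. For a two-qubit state $X$, $F(X)=\max_{|\phi\rangle}\langle\phi|X|\phi\rangle$ over two-qubit maximally entangled states; $F^\star(\rho)=\max_\Lambda F(\Lambda(\rho))$ over trace-preserving two-party LOCC maps. In a repeater with parties $A,N_1,\dots,N_n,B$ and consecutive segments each holding a two-qubit state, $F^\star_{AB}$ is the supremum over LOCC protocols among all parties ending with $AB$ state $\sigma_k$ with probability $q_k$ (outcome known to all) of $\sum_k q_kF(\sigma_k)$. One has $F^\star(\rho(p,\delta))=\frac12(1+\mathcal{C}-p)$ if $\mathcal{C}>2p$ and $\frac12(1+\mathcal{C}^2/(4p))$ if $\mathcal{C}\le2p$, where $\mathcal{C}=2\sqrt{\delta(1-\delta)}(1-p)$. *)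

(* Defs.v *)
From HB Require Import structures.
From mathcomp Require Import all_boot all_order all_algebra.
From mathcomp Require Import boolp classical_sets reals.
From mathcomp Require Import complex.

Set Implicit Arguments.
Unset Strict Implicit.
Unset Printing Implicit Defensive.

Import Order.TTheory GRing.Theory Num.Theory.
Local Open Scope ring_scope.
Local Open Scope classical_set_scope.
Local Open Scope complex_scope.

Section Quantum.
Variable R : realType.
Local Notation C := R[i].

(* a two-qubit operator X, entries <x|X|y> with x,y : 'I_2 * 'I_2 *)
Definition op2 := 'I_2 * 'I_2 -> 'I_2 * 'I_2 -> C.

Definition psi_coef (alpha : R) (x y : 'I_2) : C :=
  if x == y then (if x == ord0 then (Num.sqrt alpha)%:C
                  else (Num.sqrt (1 - alpha))%:C)
  else 0.

Definition rho (p delta : R) : op2 := fun x y =>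
  (p * ((x == (ord0, ord_max)) && (y == (ord0, ord_max)))%:R)%:C
  + (1 - p)%:C * psi_coef delta x.1 x.2 * (psi_coef delta y.1 y.2)^*.

Definition bell (k : 'I_4) (x y : 'I_2) : C :=
  let s := (Num.sqrt 2)^-1 in
  match val k with
  | 0%N => if x == y then s%:C else 0
  | 1%N => if x == y then (if x == ord0 then s%:C else (- s)%:C) else 0
  | 2%N => if x != y then s%:C else 0
  | _ => if x != y then (if x == ord0 then s%:C else (- s)%:C) else 0
  end.

(* two-qubit maximally entangled pure states: coefficient matrices phi
   (|phi> = sum_{ij} phi i j |ij>) whose reduced state on the first qubit
   is the maximally mixed state I/2 (i.e. normalized, both Schmidt
   coefficients equal to 1/sqrt 2). *)
Definition max_ent (phi : 'I_2 -> 'I_2 -> C) : Prop :=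
  forall i i' : 'I_2,
    \sum_(j : 'I_2) phi i j * (phi i' j)^* = ((i == i')%:R / 2)%:C.

(* Parties form a finType P; every party holds a local system of       *)
(* dimension m+4 (its original qubits are embedded in the first basis  *)
(* vectors, the rest serving as local ancilla).                        *)

Definition loc (m : nat) := 'I_(m.+4).
Definition glob (P : finType) (m : nat) := {ffun P -> loc m}.
Definition gop (P : finType) (m : nat) := glob P m -> glob P m -> C.

Definition lift (P : finType) m (p : P) (K : loc m -> loc m -> C) : gop P m :=
  fun g h => if [forall q, (q != p) ==> (g q == h q)] then K (g p) (h p) else 0.

Definition conjugate (P : finType) m (M omega : gop P m) : gop P m :=
  fun g h => \sum_(k : glob P m) \sum_(l : glob P m) M g k * omega k l * (M h l)^*.

Definition trace_preserving m n (K : 'I_n -> loc m -> loc m -> C) : Prop :=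
  forall x y : loc m,
    \sum_(i < n) \sum_(z : loc m) (K i z x)^* * K i z y = (x == y)%:R.

(* An LOCC protocol: either stop, or some party p performs a local
   instrument with n outcomes (broadcast to everyone), after which the
   protocol continues depending on the outcome. *)
Inductive protocol (P : finType) (m : nat) : Type :=
| PStop
| PRound (p : P) (n : nat) (K : 'I_n -> loc m -> loc m -> C)
         (next : 'I_n -> protocol P m).

Fixpoint valid (P : finType) m (pi : protocol P m) : Prop :=
  match pi with
  | PStop => True
  | PRound p n K next => trace_preserving K /\ forall i, valid (next i)
  end.

Definition emb m (x : 'I_2) : loc m := inord x.

(* <phi| tr_{others}(omega) |phi> for the two parties a b, where |phi>
   is a two-qubit state living in the qubit subspaces of a and b. *)
Definition overlap (P : finType) m (a b : P) (phi : 'I_2 -> 'I_2 -> C)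
  (omega : gop P m) : C :=
  let phit (x y : loc m) : C :=
    \sum_(i : 'I_2) \sum_(j : 'I_2)
       ((x == emb m i) && (y == emb m j))%:R * phi i j in
  \sum_(g : glob P m) \sum_(h : glob P m)
    if [forall q, ((q != a) && (q != b)) ==> (g q == h q)]
    then (phit (g a) (g b))^* * omega g h * phit (h a) (h b) else 0.

(* For an (unnormalized) final state omega = q * sigma, the quantity
   q * F(sigma_AB), F the fully entangled fraction (max over maximally
   entangled two-qubit states). *)
Definition Fw (P : finType) m (a b : P) (omega : gop P m) : R :=
  sup [set complex.Re (overlap a b phi omega) | phi in max_ent].

Fixpoint pval (P : finType) m (a b : P) (pi : protocol P m) (omega : gop P m)
  : R :=
  match pi with
  | PStop => Fw a b omega
  | PRound p n K next =>
      \sum_(i < n) pval a b (next i) (conjugate (lift p (K i)) omega)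
  end.

Definition loc2 m (x : 'I_2 * 'I_2) : glob 'I_2 m :=
  [ffun p : 'I_2 => emb m (if p == ord0 then x.1 else x.2)].

Definition embed2 m (X : op2) : gop 'I_2 m := fun g h =>
  \sum_(x : 'I_2 * 'I_2) \sum_(y : 'I_2 * 'I_2)
     ((g == loc2 m x) && (h == loc2 m y))%:R * X x y.

Definition Fstar (X : op2) : R :=
  sup [set v | exists (m : nat) (pi : protocol 'I_2 m),
                 valid pi /\ v = pval ord0 ord_max pi (embed2 (m:=m) X)].

(* Qubits (index 'I_6): 0 = A, 1 2 = N1, 3 4 = N2, 5 = B.              *)
(* Segment S1 = qubits (0,1), S2 = (2,3), S3 = (4,5).                  *)
(* Parties (index 'I_4): 0 = A, 1 = N1, 2 = N2, 3 = B.                 *)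

Definition qstr := {ffun 'I_6 -> 'I_2}.
Definition qb (s : qstr) (k : nat) : 'I_2 := s (inord k).

Definition Omega (al p delta ar : R) (s t : qstr) : C :=
  psi_coef al (qb s 0) (qb s 1) * (psi_coef al (qb t 0) (qb t 1))^*
  * rho p delta (qb s 2, qb s 3) (qb t 2, qb t 3)
  * psi_coef ar (qb s 4) (qb s 5) * (psi_coef ar (qb t 4) (qb t 5))^*.

Definition loc4 m (s : qstr) : glob 'I_4 m :=
  [ffun p : 'I_4 => inord (match val p with
                           | 0%N => val (qb s 0)
                           | 1%N => 2 * val (qb s 1) + val (qb s 2)
                           | 2%N => 2 * val (qb s 3) + val (qb s 4)
                           | _ => val (qb s 5)
                           end) : loc m].

Definition embed4 m (al p delta ar : R) : gop 'I_4 m := fun g h =>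
  \sum_(s : qstr) \sum_(t : qstr)
     ((g == loc4 m s) && (h == loc4 m t))%:R * Omega al p delta ar s t.

Definition FstarAB (al p delta ar : R) : R :=
  sup [set v | exists (m : nat) (pi : protocol 'I_4 m),
                 valid pi /\ v = pval ord0 ord_max pi (embed4 (m:=m) al p delta ar)].

(* unnormalized AB state after N1 obtains Bell outcome j and N2 obtains
   Bell outcome k (projective Bell measurements on their two qubits) *)
Definition cond_AB (al p delta ar : R) (j k : 'I_4) : op2 := fun x y =>
  \sum_(s : qstr) \sum_(t : qstr)
    if (qb s 0 == x.1) && (qb s 5 == x.2) && (qb t 0 == y.1) && (qb t 5 == y.2)
    then (bell j (qb s 1) (qb s 2))^* * (bell k (qb s 3) (qb s 4))^*
         * Omega al p delta ar s t
         * bell j (qb t 1) (qb t 2) * bell k (qb t 3) (qb t 4)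
    else 0.

Definition trace2 (X : op2) : R := complex.Re (\sum_(x : 'I_2 * 'I_2) X x x).

Definition bell_swap_value (al p delta ar : R) : R :=
  \sum_(j : 'I_4) \sum_(k : 'I_4)
    let X := cond_AB al p delta ar j k in
    let q := trace2 X in
    if q == 0 then 0 else q * Fstar (fun x y => X x y / q%:C).

End Quantum.

(* Main.v *)
(* The value of an LOCC protocol on omega is Tr(omega T) with T >= 0 and
   -1/2 <= T^Gamma <= 1/2, where Gamma is partial transposition across a cut
   separating A from B.  Hence, if omega + |w><w| has partial transpose
   sum_k |v_k><v_k|, the value is at most (sum_k ||v_k||^2) / 2.  For
   omega = t |e><e| + |z><z|, with e = |e1 e2> and z = u |e1, not e2> + v |not e1, e2>,
   taking w proportional to |not e1, not e2> gives (t + u^2 + v^2 + (uv)^2 / t) / 2,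
   which a filter on A attains when |uv| <= t.  The state rho(p, delta) has this form,
   and tensoring its witness with psi(al) and psi(ar) bounds the repeater across the
   cut A N1 | N2 B.  Each pair of Bell outcomes leaves AB in a state of the same form;
   the hypothesis says that |uv| <= t holds for the worst outcome, and the resulting
   values add up to the value of rho(p, delta). *)
Require Import Defs.
From HB Require Import structures.
From mathcomp Require Import all_boot all_order all_algebra.
From mathcomp Require Import boolp classical_sets reals.
From mathcomp Require Import complex ring lra zify.
Import Defs Order.TTheory GRing.Theory Num.Theory.
Local Open Scope complex_scope.
Local Open Scope ring_scope.

Set Implicit Arguments.
Unset Strict Implicit.
Unset Printing Implicit Defensive.

(** * Coordinates of joint basis states *)

Section Coordinates.
Variables (P T : finType).
Implicit Types (g h k : {ffun P -> T}) (p q a b : P) (x y z : T).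

Definition upd g p z : {ffun P -> T} := [ffun q => if q == p then z else g q].

Lemma updE g p z q : upd g p z q = if q == p then z else g q.
Proof. by rewrite ffunE. Qed.

Lemma upd_id g p : upd g p (g p) = g.
Proof. by apply/ffunP => q; rewrite updE; case: eqP => [->|]. Qed.

Lemma sum_agree1 (V : nmodType) (F : {ffun P -> T} -> V) p k :
  \sum_(g : {ffun P -> T} | [forall q, (q != p) ==> (g q == k q)]) F g
  = \sum_z F (upd k p z).
Proof.
rewrite (reindex_onto (fun z => upd k p z) (fun g => g p)) /=; last first.
  move=> g /forallP hg; apply/ffunP => q; rewrite updE.
  by case: eqP => [->//|/eqP nq]; have /implyP/(_ nq)/eqP := hg q.
apply: eq_bigl => z; rewrite updE eqxx eqxx andbT.
by apply/forallP => q; apply/implyP => nq; rewrite updE (negPf nq).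
Qed.

Lemma sum_agree2 (V : nmodType) (F : {ffun P -> T} -> V) a b k : a != b ->
  \sum_(g : {ffun P -> T} | [forall q, ((q != a) && (q != b)) ==> (k q == g q)]) F g
  = \sum_x \sum_y F (upd (upd k a x) b y).
Proof.
move=> ab; rewrite pair_big.
rewrite (reindex_onto (fun w => upd (upd k a w.1) b w.2)
          (fun g => (g a, g b))) /=; last first.
  move=> g /forallP hg; apply/ffunP => q; rewrite !updE.
  case: eqP => [->//|/eqP nb]; case: eqP => [->//|/eqP na].
  by have := hg q; rewrite na nb => /eqP.
apply: eq_bigl => -[x y] /=; rewrite !updE !eqxx (negPf ab) eqxx andbT.
apply/forallP => q; apply/implyP => /andP[na nb].
by rewrite !updE (negPf na) (negPf nb).
Qed.

(** Joint states that differ only at [a] and [b] form a fibre. The arbitrary value [z] selects one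
    representative per fibre, so that a trace over the other parties becomes a sum over
    representatives. *)
Lemma sum_fiber2 (V : nmodType) (F : {ffun P -> T} -> V) a b z : a != b ->
  \sum_g F g = \sum_(g : {ffun P -> T} | (g a == z) && (g b == z))
                  \sum_x \sum_y F (upd (upd g a x) b y).
Proof.
move=> ab; under [RHS]eq_bigr do rewrite pair_big /=.
rewrite pair_big_dep /=.
rewrite [RHS](reindex_onto (fun g => (upd (upd g a z) b z, (g a, g b)))
  (fun w => upd (upd w.1 a w.2.1) b w.2.2)) /=; last first.
  move=> [g [x y]] /andP[/andP[/eqP ga /eqP gb] _] /=.
  rewrite !updE !eqxx (negPf ab); congr (_, _).
  apply/ffunP => q; rewrite !updE.
  by case: (q =P b) => [->//|_]; case: (q =P a) => [->|].
have U g : upd (upd (upd (upd g a z) b z) a (g a)) b (g b) = g.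
  apply/ffunP => q; rewrite !updE.
  by case: (q =P b) => [->//|_]; case: (q =P a) => [->|].
apply: eq_big => [g|g _]; last by rewrite U.
by rewrite U !updE !eqxx (negPf ab) /= !eqxx.
Qed.

(** Partial transposition on the parties outside [S] sends the entry at [g, h] to the entry at
    [mix S g h, mix S h g]. *)
Definition mix (S : {set P}) g h : {ffun P -> T} :=
  [ffun q => if q \in S then g q else h q].

Lemma mix_updl (S : {set P}) g h p x y : p \in S ->
  mix S (upd g p x) (upd h p y) = upd (mix S g h) p x.
Proof.
by move=> pS; apply/ffunP => q; rewrite !ffunE; case: eqP => [->|]; rewrite ?pS.
Qed.

Lemma mix_updr (S : {set P}) g h p x y : p \notin S ->
  mix S (upd g p x) (upd h p y) = upd (mix S g h) p y.
Proof.
move=> pS; apply/ffunP => q; rewrite !ffunE.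
by case: eqP => [->|]; rewrite ?(negPf pS).
Qed.

Lemma mix_upd2 (S : {set P}) g a b x y x' y' : a \in S -> b \notin S ->
  mix S (upd (upd g a x) b y) (upd (upd g a x') b y') = upd (upd g a x) b y'.
Proof.
move=> aS bS; rewrite mix_updr // mix_updl //; congr (upd (upd _ _ _) _ _).
by apply/ffunP => q; rewrite ffunE; case: ifP.
Qed.

End Coordinates.

(** * The partial-transpose bound on LOCC protocols *)

Section UpperBound.
Variable R : realType.
Local Notation C := R[i].

Definition sqnorm (z : C) : R := complex.Re z ^+ 2 + complex.Im z ^+ 2.

Lemma sqnormE (z : C) : (sqnorm z)%:C = z * z^*.
Proof.
case: z => a b; rewrite /sqnorm /=; apply/eqP; rewrite eq_complex /=.
by apply/andP; split; apply/eqP; ring.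
Qed.

Lemma sqnorm_ge0 (z : C) : 0 <= sqnorm z.
Proof. by rewrite addr_ge0 // sqr_ge0. Qed.

Lemma Re_mulJ (z w : C) : complex.Re (z * w^*) <= (sqnorm z + sqnorm w) / 2.
Proof.
case: z w => a b [c d]; rewrite /sqnorm /=.
have := sqr_ge0 (a - c); have := sqr_ge0 (b - d); nra.
Qed.

Lemma conjRC (x : R) : (x%:C)^* = x%:C.
Proof. exact: conjc_real. Qed.

Lemma RC_inj : injective (fun x : R => x%:C).
Proof. by move=> x y []. Qed.

Lemma sumRC (I : finType) (Q : pred I) (F : I -> R) :
  (\sum_(i | Q i) F i)%:C = \sum_(i | Q i) (F i)%:C.
Proof. exact: (rmorph_sum (real_complex R)). Qed.

Lemma ReB (z w : C) : complex.Re (z - w) = complex.Re z - complex.Re w.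
Proof. by case: z w => a b []. Qed.

Lemma Re_sum (I : finType) (Q : pred I) (F : I -> C) :
  complex.Re (\sum_(i | Q i) F i) = \sum_(i | Q i) complex.Re (F i).
Proof. by apply: (big_morph (@complex.Re R)) => // -[a b] []. Qed.

Section LocalOps.
Variables (P : finType) (m : nat).
Implicit Types (v w : glob P m -> C) (g h : glob P m) (K : loc m -> loc m -> C).

Definition local_apply (p : P) K v g : C := \sum_z K (g p) z * v (upd g p z).

Lemma agree_sym (p : P) g h :
  [forall q, (q != p) ==> (g q == h q)] = [forall q, (q != p) ==> (h q == g q)].
Proof. by apply: eq_forallb => q; rewrite [g q == _]eq_sym. Qed.

Lemma sum_lift (p : P) K v g : \sum_k lift p K g k * v k = local_apply p K v g.
Proof.
rewrite /local_apply /lift.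
have -> : \sum_z K (g p) z * v (upd g p z)
   = \sum_z K (g p) (upd g p z p) * v (upd g p z).
  by apply: eq_bigr => z _; rewrite updE eqxx.
rewrite -(sum_agree1 (fun k => K (g p) (k p) * v k)) [RHS]big_mkcond.
by apply: eq_bigr => k _; rewrite agree_sym; case: ifP => // _; rewrite mul0r.
Qed.

Lemma conjugateE (p : P) K (omega : gop R P m) g h :
  conjugate (lift p K) omega g h =
  \sum_z \sum_z' K (g p) z * omega (upd g p z) (upd h p z') * (K (h p) z')^*.
Proof.
rewrite /conjugate.
transitivity (\sum_k lift p K g k * \sum_z' omega k (upd h p z') * (K (h p) z')^*).
  apply: eq_bigr => k _; under eq_bigr do rewrite -mulrA.
  rewrite -big_distrr /=; congr (_ * _).
  have := sum_lift p K (fun l => (omega k l)^*) h.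
  move/(congr1 Num.conj); rewrite !rmorph_sum /= => E.
  under eq_bigr => l _ do rewrite mulrC -{1}[omega k l]conjCK -rmorphM /=.
  rewrite E; apply: eq_bigr => z _.
  by rewrite rmorphM /= conjCK mulrC.
rewrite (sum_lift p K (fun k => \sum_z' omega k (upd h p z') * (K (h p) z')^*)).
apply: eq_bigr => z _; rewrite big_distrr /=.
by apply: eq_bigr => z' _; rewrite mulrA.
Qed.

(** Trace preservation passes from one party to all: each entry factors into a local entry at [p]
    and the agreement of [g] and [h] away from [p]. *)
Lemma lift_adj (p : P) n (K : 'I_n -> loc m -> loc m -> C) g h :
  trace_preserving K ->
  \sum_(i < n) \sum_k (lift p (K i) k g)^* * lift p (K i) k h = (g == h)%:R.
Proof.
move=> tpK.
transitivity (\sum_(i < n) \sum_z (K i z (g p))^* *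
    (if [forall q, (q != p) ==> (g q == h q)] then K i z (h p) else 0)).
  apply: eq_bigr => i _.
  transitivity (\sum_z (K i (upd g p z p) (g p))^* * lift p (K i) (upd g p z) h).
    rewrite -(sum_agree1 (fun k => (K i (k p) (g p))^* * lift p (K i) k h)).
    rewrite [RHS]big_mkcond; apply: eq_bigr => k _; rewrite {1}/lift.
    by case: ifP => // _; rewrite rmorph0 mul0r.
  apply: eq_bigr => z _; rewrite /lift updE eqxx; congr (_ * _).
  suff -> : [forall q, (q != p) ==> (upd g p z q == h q)]
          = [forall q, (q != p) ==> (g q == h q)] by [].
  by apply: eq_forallb => q; rewrite updE; case: eqP.
case: (boolP [forall q, (q != p) ==> (g q == h q)]) => [/forallP ag|/negP ag]; last first.
  rewrite big1; last by move=> i _; rewrite big1 // => z _; rewrite mulr0.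
  case: eqP => // gh; case: ag; apply/forallP => q; rewrite gh eqxx.
  exact: implybT.
rewrite tpK; congr (_%:R); congr nat_of_bool.
apply/eqP/eqP => [gh|->//]; apply/ffunP => q.
by case: (eqVneq q p) => [->//|nq]; have /implyP/(_ nq)/eqP := ag q.
Qed.

(** Expanding the squared norms leaves the sum over outcomes of the adjoint of [K i] times [K i],
    which is the identity. This is what keeps the final bound constant along the protocol tree. *)
Lemma local_apply_norm (p : P) n (K : 'I_n -> loc m -> loc m -> C) v :
  trace_preserving K ->
  \sum_(i < n) \sum_g sqnorm (local_apply p (K i) v g) = \sum_g sqnorm (v g).
Proof.
move=> tpK; apply: RC_inj; rewrite !sumRC.
transitivity (\sum_k \sum_l v k * (v l)^* *
   \sum_(i < n) \sum_g (lift p (K i) g l)^* * lift p (K i) g k).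
  under eq_bigr => i _.
    rewrite sumRC; under eq_bigr => g _.
      rewrite sqnormE -sum_lift rmorph_sum big_distrl /=.
      under eq_bigr => k _ do rewrite big_distrr /=.
      over.
    rewrite exchange_big /=; under eq_bigr => k _ do rewrite exchange_big /=.
    over.
  rewrite exchange_big /=; apply: eq_bigr => k _.
  rewrite exchange_big /=; apply: eq_bigr => l _.
  rewrite big_distrr /=; apply: eq_bigr => i _.
  rewrite big_distrr /=; apply: eq_bigr => g _.
  by rewrite rmorphM /=; ring.
apply: eq_bigr => k _; rewrite sqnormE (bigD1 k) //= lift_adj // eqxx mulr1.
by rewrite big1 ?addr0 // => l /negPf nl; rewrite lift_adj // nl mulr0.
Qed.

Lemma local_apply_conj_norm (p : P) n (K : 'I_n -> loc m -> loc m -> C) v :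
  trace_preserving K ->
  \sum_(i < n) \sum_g sqnorm (local_apply p (fun x y => (K i x y)^*) v g)
  = \sum_g sqnorm (v g).
Proof.
move=> tpK; apply: (@local_apply_norm p n (fun i x y => (K i x y)^*)) => x y.
have := congr1 Num.conj (tpK x y); rewrite rmorph_nat rmorph_sum => <-.
apply: eq_bigr => i _; rewrite rmorph_sum; apply: eq_bigr => z _.
by rewrite rmorphM.
Qed.

(* The rank-one operator |v><v|, partially transposed on the parties outside S. *)
Definition twist (S : {set P}) v : gop R P m :=
  fun g h => v (mix S g h) * (v (mix S h g))^*.

Definition rank_one v : gop R P m := fun g h => v g * (v h)^*.

Definition local_applyS (S : {set P}) (p : P) K v :=
  local_apply p (if p \in S then K else fun x y => (K x y)^*) v.

(** An operator acting on a transposed index acts through its entrywise conjugate, so a twisted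
    rank-one operator stays twisted rank-one under every local operation. *)
Lemma conjugate_twist (S : {set P}) (p : P) K v :
  conjugate (lift p K) (twist S v) = twist S (local_applyS S p K v).
Proof.
apply: funext => g; apply: funext => h.
rewrite conjugateE /twist /local_applyS /local_apply.
rewrite rmorph_sum big_distrl /=; case: ifPn => pS.
  apply: eq_bigr => z _; rewrite big_distrr; apply: eq_bigr => z' _ /=.
  by rewrite !mix_updl // rmorphM /= !ffunE pS; ring.
rewrite exchange_big; apply: eq_bigr => z _.
rewrite big_distrr; apply: eq_bigr => z' _ /=.
by rewrite !mix_updr // !rmorphM /= conjCK !ffunE (negPf pS); ring.
Qed.

Lemma conjugate_rank_one (p : P) K v :
  conjugate (lift p K) (rank_one v) = rank_one (local_apply p K v).
Proof.
apply: funext => g; apply: funext => h; rewrite conjugateE /rank_one /local_apply.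
rewrite rmorph_sum big_distrl /=.
apply: eq_bigr => z _; rewrite big_distrr; apply: eq_bigr => z' _ /=.
by rewrite rmorphM /=; ring.
Qed.


(** The zero-padded vector that occurs as [phit] inside [overlap]. *)
Definition qubit_ext (phi : 'I_2 -> 'I_2 -> C) (x y : loc m) : C :=
  \sum_(i : 'I_2) \sum_(j : 'I_2) ((x == emb m i) && (y == emb m j))%:R * phi i j.

Lemma overlapE (a b : P) phi (omega : gop R P m) (z : loc m) : a != b ->
  overlap a b phi omega =
  \sum_(g : glob P m | (g a == z) && (g b == z)) \sum_x \sum_y \sum_x' \sum_y'
     (qubit_ext phi x y)^* * omega (upd (upd g a x) b y) (upd (upd g a x') b y')
     * qubit_ext phi x' y'.
Proof.
move=> ab; rewrite /overlap (sum_fiber2 _ z ab).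
apply: eq_bigr => g _; apply: eq_bigr => x _; apply: eq_bigr => y _.
rewrite -big_mkcond sum_agree2 //.
apply: eq_bigr => x' _; apply: eq_bigr => y' _.
rewrite !updE !eqxx (negPf ab) -/(qubit_ext phi x y) -/(qubit_ext phi x' y').
congr (_ * omega _ _ * _); apply/ffunP => q; rewrite !updE.
by case: (q =P b) => // _; case: (q =P a).
Qed.

Lemma emb_inj : injective (emb m).
Proof.
have h (i : 'I_2) : nat_of_ord (emb m i) = i.
  by rewrite /emb inordK // (leq_trans (ltn_ord i)).
by move=> i j /(congr1 val) /=; rewrite !h => /val_inj.
Qed.

Lemma sum_emb (V : nmodType) (f : loc m -> V) :
  \sum_x f x = \sum_i f (emb m i) + \sum_(x | x \notin [set emb m i | i : 'I_2]) f x.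
Proof.
rewrite (bigID (mem [set emb m i | i : 'I_2])) /=; congr (_ + _).
by rewrite big_imset //= => i j _ _; exact: emb_inj.
Qed.

(** Orthogonality of the rows says that twice the adjoint of [phi] is a right inverse of [phi]. For
    square matrices it is then a left inverse, which is orthogonality of the columns. *)
Lemma max_ent_col (phi : 'I_2 -> 'I_2 -> C) : max_ent phi ->
  forall j j' : 'I_2, \sum_i phi i j * (phi i j')^* = ((j == j')%:R / 2)%:C.
Proof.
move=> me j j'.
pose A : 'M[C]_2 := \matrix_(i, k) phi i k.
pose B : 'M[C]_2 := \matrix_(i, k) (2 * (phi k i)^*).
have AB : A *m B = 1%:M.
  apply/matrixP => i i'; rewrite !mxE.
  transitivity (2 * \sum_k phi i k * (phi i' k)^*).
    by rewrite big_distrr; apply: eq_bigr => k _; rewrite !mxE /=; ring.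
  rewrite me rmorphM /= fmorphV !rmorph_nat mulrC mulfVK ?pnatr_eq0 //.
have /matrixP/(_ j' j) := mulmx1C AB; rewrite !mxE eq_sym => E.
rewrite rmorphM /= fmorphV !rmorph_nat -E big_distrl /=.
apply: eq_bigr => i _; rewrite !mxE mulrAC mulrC [2 * _]mulrC.
by rewrite mulfK ?pnatr_eq0.
Qed.

Lemma max_ent_norm (phi : 'I_2 -> 'I_2 -> C) (u : 'I_2 -> C) : max_ent phi ->
  \sum_i sqnorm (\sum_j u j * phi i j) = (\sum_j sqnorm (u j)) / 2.
Proof.
move=> /max_ent_col me; apply: RC_inj; rewrite rmorphM /= !sumRC.
transitivity (\sum_j \sum_j' u j * (u j')^* * \sum_i phi i j * (phi i j')^*).
  under eq_bigr => i _.
    rewrite sqnormE rmorph_sum big_distrl /=.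
    under eq_bigr => j _ do rewrite big_distrr /=.
    over.
  rewrite exchange_big; apply: eq_bigr => j _ /=.
  rewrite exchange_big; apply: eq_bigr => j' _ /=.
  rewrite big_distrr; apply: eq_bigr => i _ /=.
  by rewrite rmorphM /=; ring.
rewrite big_distrl; apply: eq_bigr => j _ /=; rewrite sqnormE (bigD1 j) //= me eqxx.
rewrite big1 ?addr0 ?mul1r // => j' nj; rewrite me eq_sym (negPf nj).
by rewrite mul0r mulr0.
Qed.

(** On the qubit components of [u], [phi] acts as a unitary divided by sqrt 2. The remaining
    components of [u] are annihilated, whence an inequality. *)
Lemma qubit_ext_norm (phi : 'I_2 -> 'I_2 -> C) (u : loc m -> C) : max_ent phi ->
  \sum_x sqnorm (\sum_y u y * qubit_ext phi x y) <= (\sum_y sqnorm (u y)) / 2.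
Proof.
move=> me.
have E x : \sum_y u y * qubit_ext phi x y
   = \sum_i (x == emb m i)%:R * \sum_j u (emb m j) * phi i j.
  under eq_bigr => y _.
    rewrite big_distrr /=; under eq_bigr => i _ do rewrite big_distrr /=.
    over.
  rewrite exchange_big; apply: eq_bigr => i _ /=.
  rewrite exchange_big big_distrr; apply: eq_bigr => j _ /=.
  rewrite (bigD1 (emb m j)) //= eqxx andbT big1 ?addr0; first by ring.
  by move=> y /negPf ny; rewrite ny andbF mul0r mulr0.
rewrite (sum_emb (fun x => sqnorm (\sum_y u y * qubit_ext phi x y))) /=.
rewrite [X in _ + X]big1 ?addr0; last first.
  move=> x /imsetP nx; rewrite E big1 ?/sqnorm ?expr0n ?addr0 // => i _.
  case: eqP => [xi|]; last by rewrite mul0r.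
  by case: nx; exists i.
have -> : \sum_i sqnorm (\sum_y u y * qubit_ext phi (emb m i) y)
   = \sum_i sqnorm (\sum_j u (emb m j) * phi i j).
  apply: eq_bigr => i _; rewrite E (bigD1 i) //= eqxx mul1r [X in _ + X]big1 ?addr0 //.
  by move=> j /negPf nj; rewrite (inj_eq emb_inj) eq_sym nj mul0r.
rewrite max_ent_norm // ler_pM2r ?invr_gt0 ?ltr0n //.
rewrite (sum_emb (fun x => sqnorm (u x))) lerDl sumr_ge0 // => x _; exact: sqnorm_ge0.
Qed.

(** This is the estimate that a partially transposed maximally entangled projector is at most 1/2.
    With [W] the product of [V] and the transpose of [phi], the form pairs [W x x'] with the
    conjugate of [W x' x], so it is at most the squared norm of [W], hence at most half that of
    [V]. *)
Lemma twist_form (phi : 'I_2 -> 'I_2 -> C) (V : loc m -> loc m -> C) :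
  max_ent phi ->
  complex.Re (\sum_x \sum_y \sum_x' \sum_y'
     (qubit_ext phi x y)^* * (V x y' * (V x' y)^*) * qubit_ext phi x' y')
  <= (\sum_x \sum_y sqnorm (V x y)) / 2.
Proof.
move=> me; pose W x x' := \sum_y V x y * qubit_ext phi x' y.
have -> : \sum_x \sum_y \sum_x' \sum_y'
     (qubit_ext phi x y)^* * (V x y' * (V x' y)^*) * qubit_ext phi x' y'
   = \sum_x \sum_x' W x x' * (W x' x)^*.
  apply: eq_bigr => x _; rewrite exchange_big; apply: eq_bigr => x' _ /=.
  rewrite exchange_big big_distrl /=; apply: eq_bigr => y' _ /=.
  rewrite rmorph_sum big_distrr; apply: eq_bigr => y _ /=.
  by rewrite rmorphM /=; ring.
rewrite Re_sum; under eq_bigr do rewrite Re_sum.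
apply: (@le_trans _ _ (\sum_x \sum_x' sqnorm (W x x'))).
  have -> : \sum_x \sum_x' sqnorm (W x x') =
      \sum_x \sum_x' (sqnorm (W x x') + sqnorm (W x' x)) / 2.
    under [RHS]eq_bigr => x _ do rewrite -big_distrl big_split /=.
    rewrite -big_distrl big_split /= [in X in _ + X]exchange_big /=.
    by set A := \sum_x _; field.
  by apply: ler_sum => x _; apply: ler_sum => x' _; exact: Re_mulJ.
rewrite big_distrl /=; apply: ler_sum => x _; exact: qubit_ext_norm.
Qed.

Lemma rank_one_form (phi : 'I_2 -> 'I_2 -> C) (w : loc m -> loc m -> C) :
  0 <= complex.Re (\sum_x \sum_y \sum_x' \sum_y'
     (qubit_ext phi x y)^* * (w x y * (w x' y')^*) * qubit_ext phi x' y').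
Proof.
pose s := \sum_x \sum_y (qubit_ext phi x y)^* * w x y.
have -> : \sum_x \sum_y \sum_x' \sum_y'
     (qubit_ext phi x y)^* * (w x y * (w x' y')^*) * qubit_ext phi x' y' = s * s^*.
  have -> : s^* = \sum_x' \sum_y' qubit_ext phi x' y' * (w x' y')^*.
    rewrite rmorph_sum; apply: eq_bigr => x _; rewrite rmorph_sum.
    by apply: eq_bigr => y _; rewrite rmorphM /= conjCK.
  rewrite /s big_distrl; apply: eq_bigr => x _ /=.
  rewrite big_distrl; apply: eq_bigr => y _ /=.
  rewrite big_distrr; apply: eq_bigr => x' _ /=.
  rewrite big_distrr; apply: eq_bigr => y' _ /=.
  by ring.
by rewrite -sqnormE sqnorm_ge0.
Qed.

Lemma overlap_sum a b phi (I : finType) (omega : I -> gop R P m) :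
  overlap a b phi (fun g h => \sum_k omega k g h)
  = \sum_k overlap a b phi (omega k).
Proof.
rewrite /overlap [RHS]exchange_big; apply: eq_bigr => g _ /=.
rewrite [RHS]exchange_big; apply: eq_bigr => h _ /=.
by case: ifP => _; [rewrite [X in X * _ = _]mulr_sumr mulr_suml | rewrite big1].
Qed.

Lemma overlapB a b phi (omega omega' : gop R P m) :
  overlap a b phi (fun g h => omega g h - omega' g h)
  = overlap a b phi omega - overlap a b phi omega'.
Proof.
rewrite /overlap -sumrB; apply: eq_bigr => g _; rewrite -sumrB; apply: eq_bigr => h _.
by case: ifP => _; [rewrite mulrBr mulrBl | rewrite subr0].
Qed.

(** The operators to which the bound applies: adding |w><w| makes the partial transpose a sum of
    rank-one positive terms. *)
Definition witness (S : {set P}) n (v : 'I_n -> glob P m -> C) w : gop R P m :=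
  fun g h => \sum_k twist S (v k) g h - rank_one w g h.

Lemma overlap_witness (a b : P) phi (S : {set P}) n (v : 'I_n -> glob P m -> C) w :
  max_ent phi -> a \in S -> b \notin S ->
  complex.Re (overlap a b phi (@witness S n v w)) <= (\sum_k \sum_g sqnorm (v k g)) / 2.
Proof.
move=> me aS bS; have ab : a != b by apply: contraNneq bS => <-.
rewrite /witness overlapB overlap_sum ReB Re_sum.
(* The subtracted rank-one term can only lower the value, so it is dropped. *)
have w0 : 0 <= complex.Re (overlap a b phi (rank_one w)).
  rewrite (overlapE _ _ ord0 ab) Re_sum; apply: sumr_ge0 => g _.
  exact: (rank_one_form phi (fun x y => w (upd (upd g a x) b y))).
apply: le_trans (_ : _ <= \sum_k complex.Re (overlap a b phi (twist S (v k)))) _.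
  by rewrite gerBl.
rewrite big_distrl /=; apply: ler_sum => k _.
(* Both sides are cut into fibres over the other parties. Within a fibre the twist only exchanges
   the values at [b], which is the situation of [twist_form]. *)
rewrite (overlapE _ _ ord0 ab) (sum_fiber2 _ ord0 ab) Re_sum big_distrl /=.
apply: ler_sum => g _.
have := twist_form (fun x y => v k (upd (upd g a x) b y)) me.
congr (complex.Re _ <= _).
apply: eq_bigr => x _; apply: eq_bigr => y _; apply: eq_bigr => x' _.
by apply: eq_bigr => y' _; rewrite /twist !mix_upd2.
Qed.

End LocalOps.

Lemma max_ent_phi (e1 e2 : 'I_2) (s : R) : s ^+ 2 = 1 ->
  max_ent (fun i j => ((if (i == e1) && (j == e2) then 1 else
     if (i != e1) && (j != e2) then s else 0) / Num.sqrt 2)%:C).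
Proof.
move=> s1.
have h : (Num.sqrt 2)^-1 * (Num.sqrt 2)^-1 = 2^-1 :> R.
  by rewrite -invfM -expr2 sqr_sqrtr ?ler0n.
have h1 : s * (Num.sqrt 2)^-1 * (s * (Num.sqrt 2)^-1) = 2^-1 :> R.
  by rewrite mulrACA h -expr2 s1 mul1r.
move=> i i'; rewrite !big_ord_recl big_ord0 addr0.
case: e1 e2 i i' => [[|[|//]] ?] [[|[|//]] ?] [[|[|//]] ?] [[|[|//]] ?].
all: rewrite /= !conjRC -!rmorphM -!rmorphD /=; congr (_%:C).
all: by rewrite ?mul0r ?mulr0 ?mul1r ?addr0 ?add0r ?h ?h1.
Qed.

Section Protocols.
Variables (P : finType) (m : nat) (a b : P).

Lemma Fw_le (omega : gop R P m) B :
  (forall phi, max_ent phi -> complex.Re (overlap a b phi omega) <= B) ->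
  Fw a b omega <= B.
Proof.
move=> h; apply: ge_sup.
  by eexists; apply: imageP; exact: (max_ent_phi ord0 ord0 (expr1n _ 2)).
by move=> _ [phi me <-]; exact: h.
Qed.

(** Closure of the witness shape under each Kraus operator is what makes induction over protocols
    possible. *)
Lemma conjugate_witness S (p : P) K n v w :
  conjugate (lift p K) (@witness P m S n v w)
  = witness S (fun k => local_applyS S p K (v k)) (local_apply p K w).
Proof.
apply: funext => g; apply: funext => h; rewrite /witness -conjugate_rank_one.
under [X in _ = X - _]eq_bigr do rewrite -conjugate_twist.
rewrite !conjugateE; under [X in _ = X - _]eq_bigr do rewrite conjugateE.
rewrite [X in _ = X - _]exchange_big -sumrB; apply: eq_bigr => z _ /=.
rewrite [X in _ = X - _]exchange_big -sumrB; apply: eq_bigr => z' _ /=.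
by rewrite mulrBr mulrBl mulr_sumr mulr_suml.
Qed.

(* Partial transposition turns the local operations of the parties outside S
   into their complex conjugates, which are again trace preserving. *)
Lemma pval_witness (S : {set P}) (pi : protocol R P m) n v w :
  a \in S -> b \notin S -> valid pi ->
  pval a b pi (@witness P m S n v w) <= (\sum_k \sum_g sqnorm (v k g)) / 2.
Proof.
move=> aS bS; elim: pi v w => [v w _ | p r K next IH v w [tpK vn]] /=.
  by apply: Fw_le => phi me; exact: overlap_witness.
apply: le_trans (_ : _ <= \sum_(i < r)
   (\sum_k \sum_g sqnorm (local_applyS S p (K i) (v k) g)) / 2) _.
  by apply: ler_sum => i _; rewrite conjugate_witness; exact: (IH i _ _ (vn i)).
rewrite -big_distrl exchange_big /=.
suff -> : \sum_k \sum_(i < r) \sum_g sqnorm (local_applyS S p (K i) (v k) g) =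
   \sum_k \sum_g sqnorm (v k g) by [].
apply: eq_bigr => k _; rewrite /local_applyS; case: (p \in S).
  exact: local_apply_norm.
exact: local_apply_conj_norm.
Qed.

End Protocols.
End UpperBound.

(** * Operators supported on labelled basis states *)

Section Embeddings.
Variable R : realType.
Local Notation C := R[i].
Variables (P X : finType) (m : nat) (gl : X -> glob P m).
Implicit Types (W : X -> X -> C) (v : X -> C).

(** Common form of [embed2] and [embed4], for an arbitrary labelling [gl] of joint basis states. *)
Definition embed_op W : gop R P m := fun g h =>
  \sum_x \sum_y ((g == gl x) && (h == gl y))%:R * W x y.

Definition embed_vec v (g : glob P m) : C := \sum_x (g == gl x)%:R * v x.

Lemma embed_vec_norm v : injective gl ->
  \sum_g sqnorm (embed_vec v g) = \sum_x sqnorm (v x).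
Proof.
move=> gl_inj; apply: RC_inj; rewrite !sumRC.
transitivity (\sum_x \sum_y v x * (v y)^* *
                \sum_g ((g == gl x)%:R * (g == gl y)%:R)).
  under eq_bigr => g _.
    rewrite sqnormE rmorph_sum big_distrl /=.
    under eq_bigr => x _ do rewrite big_distrr /=.
    over.
  rewrite exchange_big; apply: eq_bigr => x _ /=.
  rewrite exchange_big; apply: eq_bigr => y _ /=.
  rewrite big_distrr; apply: eq_bigr => g _ /=.
  by rewrite rmorphM rmorph_nat /=; ring.
apply: eq_bigr => x _; rewrite sqnormE (bigD1 x) //=.
rewrite (bigD1 (gl x)) //= !eqxx !mulr1 big1 ?addr0; last first.
  by move=> g /negPf ->; rewrite mul0r.
rewrite ?mulr1 [X in _ + X]big1 ?addr0 // => y yx.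
rewrite [\sum_g _]big1 ?mulr0 // => g _; case: (g =P gl x) => [->|]; last first.
  by rewrite mul0r.
by rewrite (inj_eq gl_inj) eq_sym (negPf yx) mulr0.
Qed.

(** Lets a witness be checked on labels: [mixX] is the partial transposition of labels, [gl] carries
    it to [mix S], and an injective labelling preserves norms. *)
Lemma pval_Emb (S : {set P}) (a b : P) (mixX : X -> X -> X)
  (pi : protocol R P m) W n (v : 'I_n -> X -> C) w :
  injective gl -> a \in S -> b \notin S ->
  (forall x y, mixX (mixX x y) (mixX y x) = x) ->
  (forall x y, gl (mixX x y) = mix S (gl x) (gl y)) ->
  (forall x y, W x y = \sum_k v k (mixX x y) * (v k (mixX y x))^* - w x * (w y)^*) ->
  valid pi ->
  pval a b pi (embed_op W) <= (\sum_k \sum_x sqnorm (v k x)) / 2.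
Proof.
move=> gl_inj aS bS mixK gl_mix WE vpi.
have -> : embed_op W = witness S (fun k => embed_vec (v k)) (embed_vec w).
  apply: funext => g; apply: funext => h; rewrite /witness.
  have -> : rank_one (embed_vec w) g h =
      \sum_x \sum_y ((g == gl x) && (h == gl y))%:R * (w x * (w y)^*).
    rewrite /rank_one /embed_vec big_distrl; apply: eq_bigr => x _ /=.
    rewrite rmorph_sum big_distrr; apply: eq_bigr => y _ /=.
    by rewrite rmorphM rmorph_nat -mulnb natrM /=; ring.
  have T k : twist S (embed_vec (v k)) g h = \sum_x \sum_y
      ((g == gl x) && (h == gl y))%:R * (v k (mixX x y) * (v k (mixX y x))^*).
    rewrite /twist /embed_vec big_distrl /=.
    under eq_bigr => x _ do rewrite rmorph_sum big_distrr /=.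
    rewrite !pair_big /=.
    (* Exchanging the transposed halves of two labels is an involution on pairs, so the double sum
       can be reindexed along it. *)
    have swK : involutive (fun z => (mixX z.1 z.2, mixX z.2 z.1)).
      by case=> x y /=; rewrite !mixK.
    rewrite (reindex_inj (inv_inj swK)); apply: eq_bigr => -[x y] _ /=.
    rewrite !gl_mix rmorphM rmorph_nat /=.
    have mixgK (g1 g2 : glob P m) : mix S (mix S g1 g2) (mix S g2 g1) = g1.
      by apply/ffunP => q; rewrite /mix !ffunE; case: (q \in S).
    have -> : (g == gl x) && (h == gl y) =
        (mix S g h == mix S (gl x) (gl y)) && (mix S h g == mix S (gl y) (gl x)).
      apply/andP/andP => [[/eqP-> /eqP->] //|[/eqP E1 /eqP E2]].
      split; apply/eqP; first by rewrite -[LHS](mixgK g h) E1 E2 mixgK.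
      by rewrite -[LHS](mixgK h g) E1 E2 mixgK.
    by rewrite -mulnb natrM; ring.
  rewrite (eq_bigr _ (fun k _ => T k)) exchange_big -sumrB.
  apply: eq_bigr => x _; rewrite exchange_big -sumrB; apply: eq_bigr => y _.
  by rewrite WE mulrBr mulr_sumr.
apply: le_trans (pval_witness _ _ aS bS vpi) _.
by under eq_bigr do rewrite embed_vec_norm //.
Qed.

Definition diagK (d : loc m -> R) (x y : loc m) : C := ((x == y)%:R * d x)%:C.

Lemma conjugate_diagK_Emb (p : P) d W :
  conjugate (lift p (diagK d)) (embed_op W)
  = embed_op (fun x y => (d (gl x p))%:C * W x y * (d (gl y p))%:C).
Proof.
apply: funext => g; apply: funext => h; rewrite conjugateE.
rewrite (bigD1 (g p)) //= [X in _ + X]big1 ?addr0; last first.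
  move=> z nz; rewrite big1 // => z' _.
  by rewrite /diagK eq_sym (negPf nz) mul0r rmorph0 !mul0r.
rewrite (bigD1 (h p)) //= [X in _ + X]big1 ?addr0; last first.
  by move=> z nz; rewrite /diagK [_ == z]eq_sym (negPf nz) mul0r !rmorph0 mulr0.
rewrite !upd_id /diagK !eqxx !mul1r /embed_op.
rewrite big_distrr big_distrl; apply: eq_bigr => x _ /=.
rewrite big_distrr big_distrl; apply: eq_bigr => y _ /=.
case: (g =P gl x) => [->|]; last by rewrite !mul0r mulr0 mul0r.
case: (h =P gl y) => [->|]; last by rewrite !mul0r mulr0 mul0r.
by rewrite conjRC !mul1r.
Qed.

Lemma tp_diagK n (d : 'I_n -> loc m -> R) :
  (forall x, \sum_i d i x ^+ 2 = 1) -> trace_preserving (fun i => diagK (d i)).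
Proof.
move=> d1 x y.
transitivity ((x == y)%:R * \sum_i d i x ^+ 2)%:C; last first.
  by rewrite d1 mulr1 rmorph_nat.
rewrite rmorphM rmorph_nat /= sumRC big_distrr; apply: eq_bigr => i _ /=.
rewrite (bigD1 x) //= [X in _ + X]big1 ?addr0; last first.
  by move=> z nz; rewrite /diagK (negPf nz) mul0r rmorph0 mul0r.
rewrite /diagK eqxx conjRC -!rmorphM mul1r /=.
by case: eqP => _; rewrite ?mul1r ?mul0r ?mulr0 ?rmorph0 // expr2.
Qed.

End Embeddings.

(** * Two-qubit operators held by two of the parties *)

Section PairEmbedding.
Variable R : realType.
Local Notation C := R[i].
Variables (P : finType) (m : nat) (a b : P) (gl : 'I_2 * 'I_2 -> glob P m).
Hypothesis gla : forall x, gl x a = emb m x.1.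
Hypothesis glb : forall x, gl x b = emb m x.2.
Hypothesis gl_off : forall x y q, q != a -> q != b -> gl x q = gl y q.
Implicit Type W : op2 R.

Lemma qubit_ext_emb (phi : 'I_2 -> 'I_2 -> C) i j :
  qubit_ext phi (emb m i) (emb m j) = phi i j.
Proof.
rewrite /qubit_ext (bigD1 i) //= [X in _ + X]big1 ?addr0; last first.
  move=> k nk; rewrite big1 // => l _.
  by rewrite (inj_eq (@emb_inj m)) eq_sym (negPf nk) mul0r.
rewrite (bigD1 j) //= [X in _ + X]big1 ?addr0 ?eqxx ?mul1r // => k nk.
by rewrite (inj_eq (@emb_inj m) j) [j == k]eq_sym (negPf nk) andbF mul0r.
Qed.

(** By [gl_off] the other parties sit in one fixed basis state, so the trace over them always meets
    equal indices. *)
Lemma overlap_Emb (phi : 'I_2 -> 'I_2 -> C) W :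
  overlap a b phi (embed_op gl W)
  = \sum_x \sum_y (phi x.1 x.2)^* * W x y * phi y.1 y.2.
Proof.
transitivity (\sum_g \sum_h \sum_x \sum_y (((g == gl x) && (h == gl y))%:R *
    ((phi x.1 x.2)^* * W x y * phi y.1 y.2))).
  apply: eq_bigr => g _; apply: eq_bigr => h _.
  rewrite -/(qubit_ext phi (g a) (g b)) -/(qubit_ext phi (h a) (h b)).
  case: ifPn => ag.
    rewrite /embed_op [X in X * _ = _]mulr_sumr mulr_suml; apply: eq_bigr => x _.
    rewrite [X in X * _ = _]mulr_sumr mulr_suml; apply: eq_bigr => y _.
    case: (g =P gl x) => [->|]; last by rewrite !mul0r mulr0 mul0r.
    case: (h =P gl y) => [->|]; last by rewrite !mul0r mulr0 mul0r.
    by rewrite !gla !glb !qubit_ext_emb !mul1r.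
  rewrite big1 // => x _; rewrite big1 // => y _.
  case: (g =P gl x) => [gx|]; last by rewrite mul0r.
  case: (h =P gl y) => [hy|]; last by rewrite mul0r.
  case/negP: ag; apply/forallP => q; apply/implyP => /andP[qa qb].
  by rewrite gx hy (gl_off x y).
under eq_bigr => g _ do rewrite exchange_big /=.
rewrite exchange_big; apply: eq_bigr => x _ /=.
under eq_bigr => g _ do rewrite exchange_big /=.
rewrite exchange_big; apply: eq_bigr => y _ /=.
rewrite (bigD1 (gl x)) //= [X in _ + X]big1 ?addr0; last first.
  by move=> g /negPf ng; rewrite big1 // => h _; rewrite ng mul0r.
rewrite (bigD1 (gl y)) //= [X in _ + X]big1 ?addr0 ?eqxx ?mul1r // => h /negPf nh.
by rewrite nh andbF mul0r.
Qed.

Lemma sqnormM (z w : C) : sqnorm (z * w) = sqnorm z * sqnorm w.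
Proof. by apply: RC_inj; rewrite rmorphM /= !sqnormE rmorphM /=; ring. Qed.

Lemma sqnormJ (z : C) : sqnorm z^* = sqnorm z.
Proof. by apply: RC_inj; rewrite !sqnormE conjCK mulrC. Qed.

Lemma max_ent_le1 (phi : 'I_2 -> 'I_2 -> C) i j : max_ent phi -> sqnorm (phi i j) <= 1.
Proof.
move=> /(_ i i); rewrite eqxx (bigD1 j) //=.
under eq_bigr do rewrite -sqnormE.
rewrite -sqnormE -sumRC -rmorphD => /RC_inj.
have : 0 <= \sum_(k < 2 | k != j) sqnorm (phi i k).
  by apply: sumr_ge0 => k _; exact: sqnorm_ge0.
lra.
Qed.

Lemma Fw_Emb_ge phi W : max_ent phi ->
  complex.Re (\sum_x \sum_y (phi x.1 x.2)^* * W x y * phi y.1 y.2)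
  <= Fw a b (embed_op gl W).
Proof.
move=> me; rewrite -overlap_Emb; apply: ub_le_sup; last exact: imageP.
(* Entries of a maximally entangled state have modulus at most one. Any finite upper bound suffices
   here: it makes the supremum dominate its members. *)
exists (\sum_x \sum_y (sqnorm (W x y) + 1) / 2) => _ [psi mp <-].
rewrite overlap_Emb Re_sum; apply: ler_sum => x _.
rewrite Re_sum; apply: ler_sum => y _.
rewrite -[psi y.1 y.2]conjCK; apply: le_trans (Re_mulJ _ _) _.
rewrite ler_pM2r ?invr_gt0 ?ltr0n // sqnormJ sqnormM sqnormJ lerD ?max_ent_le1 //.
by rewrite ler_piMl ?sqnorm_ge0 ?max_ent_le1.
Qed.

End PairEmbedding.

(** * One incoherent term and one coherent pair *)

Section Family.
Variable R : realType.
Local Notation C := R[i].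

(* Coordinates of a two-qubit basis state are recorded as their agreement with
   a reference basis state (e1, e2), so that one computation covers all four
   positions of the incoherent term. *)
Definition fam_vec (u v : R) (b1 b2 : bool) : R :=
  u * (b1 && ~~ b2)%:R + v * (~~ b1 && b2)%:R.

Definition famB (t u v : R) (b1 b2 c1 c2 : bool) : R :=
  t * [&& b1, b2, c1 & c2]%:R + fam_vec u v b1 b2 * fam_vec u v c1 c2.

Definition fam (e1 e2 : 'I_2) (t u v : R) : op2 R := fun x y =>
  (famB t u v (x.1 == e1) (x.2 == e2) (y.1 == e1) (y.2 == e2))%:C.

(** For [rho p delta], where [t = p], [u v = C / 2] and [u^2 + v^2 = 1 - p], this is the branch
    [(1 + C^2 / (4 p)) / 2], and [|u v| <= t] is its condition [C <= 2 p]. *)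
Definition fam_value (t u v : R) : R := (t + u ^+ 2 + v ^+ 2 + (u * v) ^+ 2 / t) / 2.

Definition sum4 (F : bool -> bool -> R) : R :=
  F true true + F true false + F false true + F false false.

Lemma sum_agreement (e1 e2 : 'I_2) (F : bool -> bool -> R) :
  \sum_(x : 'I_2 * 'I_2) F (x.1 == e1) (x.2 == e2) = sum4 F.
Proof.
rewrite -(pair_bigA _ (fun i j => F (i == e1) (j == e2))) /=.
rewrite !big_ord_recl !big_ord0 !addr0 /sum4.
by case: e1 e2 => [[|[|//]] ?] [[|[|//]] ?]; rewrite /=; ring.
Qed.

(** Partial transposition moves the coherence [u v] to the pair |e1 e2>, |not e1, not e2>. The
    diagonal entry [(u v)^2 / t] supplied by [fam_neg] completes that block to the projector on the
    third vector. *)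
Definition fam_wit (t u v : R) (k : 'I_3) (b1 b2 : bool) : R :=
  match val k with
  | 0%N => u * (b1 && ~~ b2)%:R
  | 1%N => v * (~~ b1 && b2)%:R
  | _ => Num.sqrt t * (b1 && b2)%:R + u * v / Num.sqrt t * (~~ b1 && ~~ b2)%:R
  end.

Definition fam_neg (t u v : R) (b1 b2 : bool) : R :=
  u * v / Num.sqrt t * (~~ b1 && ~~ b2)%:R.

Lemma famB_wit (t u v : R) b1 b2 c1 c2 : 0 < t ->
  famB t u v b1 b2 c1 c2 =
    \sum_k fam_wit t u v k b1 c2 * fam_wit t u v k c1 b2
    - fam_neg t u v b1 b2 * fam_neg t u v c1 c2.
Proof.
move=> t0; rewrite !big_ord_recl big_ord0 /fam_wit /fam_neg /famB /fam_vec /=.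
have r0 : Num.sqrt t != 0 by rewrite gt_eqF // sqrtr_gt0.
have : Num.sqrt t ^+ 2 = t by rewrite sqr_sqrtr // ltW.
move: (Num.sqrt t) r0 => r r0 <-.
by case: b1 b2 c1 c2 => [] [] [] []; rewrite /=; field.
Qed.

Lemma fam_wit_norm (t u v : R) : 0 < t ->
  (\sum_k sum4 (fun b1 b2 => fam_wit t u v k b1 b2 ^+ 2)) / 2 = fam_value t u v.
Proof.
move=> t0; rewrite !big_ord_recl big_ord0 /fam_wit /sum4 /fam_value /=.
have r0 : Num.sqrt t != 0 by rewrite gt_eqF // sqrtr_gt0.
have : Num.sqrt t ^+ 2 = t by rewrite sqr_sqrtr // ltW.
move: (Num.sqrt t) r0 => r r0 <-; field.
exact: r0.
Qed.

Lemma sqnormR (x : R) : sqnorm x%:C = x ^+ 2.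
Proof. by rewrite /sqnorm /= expr0n addr0. Qed.

Lemma loc2_inj m : injective (@loc2 m).
Proof.
move=> [x1 x2] [y1 y2] /ffunP h.
have := h ord0; have := h ord_max; rewrite !ffunE /=.
by move=> /emb_inj-> /emb_inj->.
Qed.

Lemma pval_fam_le m (pi : protocol R 'I_2 m) e1 e2 (t u v : R) : 0 < t ->
  valid pi ->
  pval ord0 ord_max pi (embed2 (fam e1 e2 t u v)) <= fam_value t u v.
Proof.
move=> t0 vpi; rewrite -fam_wit_norm //.
pose V (k : 'I_3) (x : 'I_2 * 'I_2) := (fam_wit t u v k (x.1 == e1) (x.2 == e2))%:C.
pose w (x : 'I_2 * 'I_2) := (fam_neg t u v (x.1 == e1) (x.2 == e2))%:C.
have := @pval_Emb R 'I_2 ('I_2 * 'I_2)%type m (@loc2 m) [set ord0] ord0 ord_max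
  (fun x y => (x.1, y.2)) pi (fam e1 e2 t u v) 3 V w.
have -> : \sum_k \sum_x sqnorm (V k x)
        = \sum_k sum4 (fun b1 b2 => fam_wit t u v k b1 b2 ^+ 2).
  apply: eq_bigr => k _; rewrite -(sum_agreement e1 e2).
  by apply: eq_bigr => x _; rewrite sqnormR.
apply=> //.
- exact: loc2_inj.
- by rewrite inE.
- by rewrite inE.
- by case.
- move=> x y; apply/ffunP => q; rewrite !ffunE inE.
  by case: (q == ord0).
- move=> x y; rewrite /fam famB_wit // rmorphB rmorphM /= sumRC conjRC.
  by congr (_ - _); apply: eq_bigr => k _; rewrite conjRC -rmorphM.
Qed.

(** * The filtering protocol *)

Section Achievability.
Variables (P : finType) (m : nat) (a b : P) (gl : 'I_2 * 'I_2 -> glob P m).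
Hypothesis gla : forall x, gl x a = emb m x.1.
Hypothesis glb : forall x, gl x b = emb m x.2.
Hypothesis gl_off : forall x y q, q != a -> q != b -> gl x q = gl y q.

Lemma Fw_Emb_real_ge e1 e2 (w : bool -> bool -> bool -> bool -> R)
    (f : bool -> bool -> R) :
  max_ent (fun i j => (f (i == e1) (j == e2))%:C) ->
  sum4 (fun b1 b2 => sum4 (fun c1 c2 => f b1 b2 * w b1 b2 c1 c2 * f c1 c2))
  <= Fw a b (embed_op gl (fun x y =>
       (w (x.1 == e1) (x.2 == e2) (y.1 == e1) (y.2 == e2))%:C)).
Proof.
move=> me; apply: le_trans (Fw_Emb_ge gla glb gl_off _ me).
rewrite -(sum_agreement e1 e2) Re_sum; apply: ler_sum => x _.
rewrite -(sum_agreement e1 e2) Re_sum; apply: ler_sum => y _.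
by rewrite conjRC -!rmorphM.
Qed.

Lemma eq_rev_ord2 (i e : 'I_2) : (i == rev_ord e) = (i != e).
Proof. by case: i e => [[|[|//]] ?] [[|[|//]] ?]. Qed.

(** The Boolean [c] selects the party. A diagonal operator only rescales entries, so the result is
    still a function of the agreement bits. *)
Lemma conjugate_diagK_party (c : bool) (d : bool -> R) e1 e2 w :
  conjugate (lift (if c then a else b)
     (diagK (fun z => d (z == emb m (if c then e1 else e2)))))
   (embed_op gl (fun x y =>
       (w (x.1 == e1) (x.2 == e2) (y.1 == e1) (y.2 == e2))%:C))
  = embed_op gl (fun x y => (let f b1 b2 c1 c2 :=
       d (if c then b1 else b2) * w b1 b2 c1 c2 * d (if c then c1 else c2) in
       f (x.1 == e1) (x.2 == e2) (y.1 == e1) (y.2 == e2))%:C).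
Proof.
rewrite conjugate_diagK_Emb; congr embed_op; apply: funext => x; apply: funext => y.
case: c; rewrite ?gla ?glb !(inj_eq (@emb_inj m)) -!rmorphM //.
Qed.

(* A filters with diag(r, 1), r = |uv|/t; when the filter fails the coherence
   is lost and B measures its qubit, leaving a product state. *)
Lemma fam_achievable e1 e2 (t u v : R) : 0 < t -> `|u * v| <= t ->
  exists2 pi : protocol R P m, valid pi &
    fam_value t u v <= pval a b pi (embed_op gl (fam e1 e2 t u v)).
Proof.
move=> t0 uvt; pose r := `|u * v| / t.
have r0 : 0 <= r by rewrite divr_ge0 // ltW.
have r1 : r <= 1 by rewrite ler_pdivrMr // mul1r.
have r2 : 0 <= 1 - r ^+ 2 by rewrite subr_ge0 expr_le1.
pose q := Num.sqrt (1 - r ^+ 2).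
have qE : q ^+ 2 = 1 - r ^+ 2 by rewrite sqr_sqrtr.
(* The sign of the coherence, used as relative sign of the target state so that the cross term
   contributes [|u v|]. *)
pose s : R := if u * v < 0 then -1 else 1.
have s1 : s ^+ 2 = 1 by rewrite /s; case: ifP => _; rewrite ?sqrrN expr1n.
have suv : s * (u * v) = r * t.
  rewrite /r mulfVK ?gt_eqF // /s; case: ltP => h; first by rewrite ltr0_norm ?mulN1r.
  by rewrite ger0_norm ?mul1r.
(* Outcome 0 is the filter [diag(r, 1)]. Outcome 1 is its completion [diag(q, 0)], which leaves A in
   |e1>. *)
pose dA (i : 'I_2) (c : bool) : R :=
  if i == ord0 then (if c then r else 1) else (if c then q else 0).
pose dB (i : 'I_2) (c : bool) : R := ((i == ord0) == c)%:R.
pose KA i := diagK (fun z => dA i (z == emb m e1)).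
pose KB i := diagK (fun z => dB i (z == emb m e2)).
exists (PRound a KA (fun i =>
  if i == ord0 then PStop R P m else PRound b KB (fun=> PStop R P m))).
  split; first apply: tp_diagK => x.
    rewrite !big_ord_recl big_ord0 addr0 /dA /=.
    by case: (_ == _); rewrite /= ?qE ?expr1n ?expr0n /=; ring.
  case=> [[|[|//]] ?] //=; split => //; apply: tp_diagK => x.
  rewrite !big_ord_recl big_ord0 addr0 /dB /=.
  by case: (x == _); rewrite /= ?expr1n ?expr0n /= ?addr0 ?add0r.
rewrite /= !big_ord_recl big_ord0 addr0 /= !big_ord_recl big_ord0 addr0.
rewrite /fam; have EA i := @conjugate_diagK_party true (dA i) e1 e2.

have EB i := @conjugate_diagK_party false (dB i) e1 e2 (fun b1 b2 c1 c2 =>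
  dA (fintype.lift ord0 ord0) b1 * famB t u v b1 b2 c1 c2
  * dA (fintype.lift ord0 ord0) c1).
rewrite /= in EA EB; rewrite /KA /KB !EA !EB.
set h := (Num.sqrt 2)^-1 : R.
have hE : h ^+ 2 = 2^-1 by rewrite exprVn sqr_sqrtr ?ler0n.
(* A basis state has overlap 1/2 with a Bell state containing it. [f0] serves the failure outcome
   |e1 e2>; [f1] serves the failure outcome |e1, not e2> and, with sign [s], the successful
   filter. *)
pose f0 (b1 b2 : bool) : R :=
  (if b1 && b2 then 1 else if ~~ b1 && ~~ b2 then 1 else 0) / Num.sqrt 2.
pose f1 s (b1 b2 : bool) : R :=
  (if b1 && ~~ b2 then 1 else if ~~ b1 && b2 then s else 0) / Num.sqrt 2.
have m0 : max_ent (fun i j => (f0 (i == e1) (j == e2))%:C).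
  exact: (max_ent_phi e1 e2 (expr1n _ 2)).
have m1 s' : s' ^+ 2 = 1 -> max_ent (fun i j => (f1 s' (i == e1) (j == e2))%:C).
  move=> /(max_ent_phi e1 (rev_ord e2)); congr max_ent; apply: funext => i.
  by apply: funext => j; rewrite eq_rev_ord2 negbK.
have L1 := Fw_Emb_real_ge (fun b1 b2 c1 c2 =>
   dA ord0 b1 * famB t u v b1 b2 c1 c2 * dA ord0 c1) (m1 s s1).
have L2 := Fw_Emb_real_ge (fun b1 b2 c1 c2 => dB ord0 b2 *
   (dA (fintype.lift ord0 ord0) b1 * famB t u v b1 b2 c1 c2
    * dA (fintype.lift ord0 ord0) c1)
   * dB ord0 c2) m0.
have L3 := Fw_Emb_real_ge (fun b1 b2 c1 c2 => dB (fintype.lift ord0 ord0) b2 *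
   (dA (fintype.lift ord0 ord0) b1 * famB t u v b1 b2 c1 c2
    * dA (fintype.lift ord0 ord0) c1)
   * dB (fintype.lift ord0 ord0) c2) (m1 1 (expr1n _ 2)).
apply: le_trans (lerD L1 (lerD L2 L3)).
rewrite /sum4 /f0 /f1 /famB /fam_vec /dA /dB /= -/h /fam_value.
have -> : (u * v) ^+ 2 / t = r ^+ 2 * t.
  by rewrite /r expr_div_n real_normK ?num_real //; field; rewrite gt_eqF.
rewrite -{1}[t]mul1r.
(* Success contributes [(u r + s v)^2 / 2] and failure [q^2 (t + u^2) / 2]. By [q^2 = 1 - r^2] and
   [s u v = r t] they add up to [(t + u^2 + v^2 + r^2 t) / 2]. *)
apply: (@le_trans _ _ (h ^+ 2 * (u ^+ 2 * r ^+ 2 + v ^+ 2 * s ^+ 2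
   + 2 * r * (s * (u * v)) + q ^+ 2 * (t + u ^+ 2)))).
  by rewrite hE s1 suv qE le_eqVlt; apply/orP; left; apply/eqP; field.
by rewrite le_eqVlt; apply/orP; left; apply/eqP; ring.
Qed.
End Achievability.
End Family.

(** * Two-party values and the algebra of Bell outcomes *)

Section Repeater.
Variable R : realType.
Local Notation C := R[i].

(** The upper bound holds for every ancilla size [m], and the filter attains it already at
    [m = 0]. *)
Lemma Fstar_fam e1 e2 (t u v : R) : 0 < t -> `|u * v| <= t ->
  Fstar (fam e1 e2 t u v) = fam_value t u v.
Proof.
move=> t0 uvt; have ub : ubound [set w | exists (m : nat) (pi : protocol R 'I_2 m),
    valid pi /\ w = pval ord0 ord_max pi (embed2 (fam e1 e2 t u v))]%classic
    (fam_value t u v).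
  by move=> _ [m [pi [vpi ->]]]; exact: pval_fam_le.
apply/eqP; rewrite eq_le; apply/andP; split.
  by apply: ge_sup => //; eexists; exists 0%N, (PStop R _ _).
have [|||pi vpi le_pi] := @fam_achievable R 'I_2 0 ord0 ord_max (@loc2 0) _ _ _
  e1 e2 t u v t0 uvt.
- by move=> x; rewrite ffunE.
- by move=> x; rewrite ffunE.
- by move=> x y [[|[|//]] ?].
apply: le_trans le_pi _; apply: ub_le_sup; first by exists (fam_value t u v).
by exists 0%N, pi.
Qed.

Lemma trace2_fam e1 e2 (t u v : R) : trace2 (fam e1 e2 t u v) = t + u ^+ 2 + v ^+ 2.
Proof.
rewrite /trace2 Re_sum /fam /=.
rewrite (sum_agreement e1 e2 (fun b1 b2 => famB t u v b1 b2 b1 b2)).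
by rewrite /sum4 /famB /fam_vec /=; ring.
Qed.

Lemma fam_normalized e1 e2 (t u v q : R) : 0 < q ->
  (fun x y => fam e1 e2 t u v x y / q%:C)
  = fam e1 e2 (t / q) (u / Num.sqrt q) (v / Num.sqrt q).
Proof.
move=> q0; apply: funext => x; apply: funext => y.
rewrite /fam -fmorphV -rmorphM; congr (_%:C); rewrite /famB /fam_vec.
have r0 : Num.sqrt q != 0 by rewrite gt_eqF // sqrtr_gt0.
have : Num.sqrt q ^+ 2 = q by rewrite sqr_sqrtr // ltW.
by move: (Num.sqrt q) r0 => r r0 <-; field.
Qed.

(** [fam_value] has degree one when [t] scales like [u^2] and [v^2], so the outcome probability
    cancels against the normalization. *)
Lemma weighted_Fstar_fam e1 e2 (t u v : R) : 0 < t -> `|u * v| <= t ->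
  let X := fam e1 e2 t u v in let q := trace2 X in
  (if q == 0 then 0 else q * Fstar (fun x y => X x y / q%:C)) = fam_value t u v.
Proof.
move=> t0 uvt /=; rewrite trace2_fam; set q := t + _ + _.
have q0 : 0 < q by rewrite /q -addrA ltr_wpDr // addr_ge0 // sqr_ge0.
have r0 : 0 < Num.sqrt q by rewrite sqrtr_gt0.
have rq : Num.sqrt q ^+ 2 = q by rewrite sqr_sqrtr // ltW.
rewrite gt_eqF // fam_normalized // Fstar_fam ?divr_gt0 //; last first.
  rewrite mulf_div -expr2 rq normrM normfV (gtr0_norm q0).
  by rewrite ler_pM2r ?invr_gt0.
rewrite /fam_value; move: (Num.sqrt q) r0 rq => r r0 <-.
by field; rewrite !gt_eqF.
Qed.

Definition lam (al : R) (x : 'I_2) : R :=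
  if x == ord0 then Num.sqrt al else Num.sqrt (1 - al).

Lemma psi_coefE al x y : psi_coef al x y = ((x == y)%:R * lam al x)%:C.
Proof.
rewrite /psi_coef /lam; case: (x == y); last by rewrite mul0r.
by rewrite mul1r; case: ifP.
Qed.

Definition rho_u (p delta : R) : R := Num.sqrt (1 - p) * Num.sqrt delta.
Definition rho_v (p delta : R) : R := Num.sqrt (1 - p) * Num.sqrt (1 - delta).

Lemma rho_fam (p delta : R) : p < 1 ->
  rho p delta = fam ord0 ord_max p (rho_u p delta) (rho_v p delta).
Proof.
move=> p1; apply: funext => -[x1 x2]; apply: funext => -[y1 y2].
rewrite /rho !psi_coefE /fam conjRC -!rmorphM -rmorphD; congr (_%:C).
have : Num.sqrt (1 - p) ^+ 2 = 1 - p by rewrite sqr_sqrtr // subr_ge0 ltW.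
rewrite /famB /fam_vec /rho_u /rho_v /lam /=.
move: (Num.sqrt (1 - p)) => r <-.
case: x1 x2 y1 y2 => [[|[|//]] ?] [[|[|//]] ?] [[|[|//]] ?] [[|[|//]] ?].
all: rewrite /=; ring.
Qed.

(** Outcomes 0 and 1 are the correlated Bell states, 2 and 3 the anticorrelated ones; the parity of
    the outcome gives the relative sign. *)
Definition flip (j : 'I_4) (x : 'I_2) : 'I_2 := if (j < 2)%N then x else rev_ord x.

Definition bell_sign (j : 'I_4) (x : 'I_2) : R :=
  if odd j && (x != ord0) then -1 else 1.

Lemma flipK j : involutive (flip j).
Proof. by move=> x; rewrite /flip; case: (j < 2)%N; rewrite ?rev_ordK. Qed.

Lemma flip_eq j x y : (flip j x == y) = (x == flip j y).
Proof. by rewrite -(inj_eq (inv_inj (flipK j))) flipK. Qed.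

Lemma flip0 j : flip j ord0 = rev_ord (flip j ord_max).
Proof. by rewrite /flip; case: ifP => _; apply: val_inj. Qed.

Lemma bell_sign2 j x : bell_sign j x ^+ 2 = 1.
Proof. by rewrite /bell_sign; case: ifP => _; rewrite ?sqrrN expr1n. Qed.

Lemma bellE j x y :
  bell R j x y = ((y == flip j x)%:R * (bell_sign j x / Num.sqrt 2))%:C.
Proof.
rewrite /bell /flip /bell_sign.
case: j x y => [[|[|[|[|//]]]] ?] [[|[|//]] ?] [[|[|//]] ?]; rewrite /= ?mul0r //.
all: by rewrite ?mul1r ?mulN1r.
Qed.

Definition mk_qstr (q0 q1 q2 q3 q4 q5 : 'I_2) : qstr :=
  [ffun i : 'I_6 => nth ord0 [:: q0; q1; q2; q3; q4; q5] i].

Lemma qb_mk q0 q1 q2 q3 q4 q5 k : (k < 6)%N ->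
  qb (mk_qstr q0 q1 q2 q3 q4 q5) k = nth ord0 [:: q0; q1; q2; q3; q4; q5] k.
Proof. by move=> k6; rewrite /qb ffunE inordK. Qed.

Lemma mk_qstrK (s : qstr) :
  mk_qstr (qb s 0) (qb s 1) (qb s 2) (qb s 3) (qb s 4) (qb s 5) = s.
Proof.
apply/ffunP => i; rewrite ffunE /qb -[in RHS](inord_val i).
by case: i => [[|[|[|[|[|[|//]]]]]] ?].
Qed.

Lemma sum_qstr (V : nmodType) (F : 'I_2 -> 'I_2 -> 'I_2 -> 'I_2 -> 'I_2 -> 'I_2 -> V) :
  \sum_(s : qstr) F (qb s 0) (qb s 1) (qb s 2) (qb s 3) (qb s 4) (qb s 5)
  = \sum_q0 \sum_q1 \sum_q2 \sum_q3 \sum_q4 \sum_q5 F q0 q1 q2 q3 q4 q5.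
Proof.
rewrite !pair_big /=.
rewrite (reindex (fun w : 'I_2 * 'I_2 * 'I_2 * 'I_2 * 'I_2 * 'I_2 =>
  mk_qstr w.1.1.1.1.1 w.1.1.1.1.2 w.1.1.1.2 w.1.1.2 w.1.2 w.2)) /=.
  by apply: eq_bigr => w _; rewrite !qb_mk.
exists (fun s => (qb s 0, qb s 1, qb s 2, qb s 3, qb s 4, qb s 5)).
  by case=> [[[[[q0 q1] q2] q3] q4] q5] _ /=; rewrite !qb_mk.
by move=> s _; rewrite /= mk_qstrK.
Qed.

(** * Bell measurements on the two outer segments *)

Section Swap.
Variables (al p delta ar : R).
Hypothesis p_lt1 : p < 1.
Let u := rho_u p delta.
Let v := rho_v p delta.

Definition swap_coef (j k : 'I_4) (x1 x2 : 'I_2) : R :=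
  bell_sign j x1 * bell_sign k (flip k x2) * lam al x1 * lam ar x2 / 2.

(** The Schmidt correlations of the outer segments and the two Bell outcomes determine all six bits
    from those of A and B. The factor 1/2 in [swap_coef] comes from two Bell amplitudes. *)
Lemma swap_delta (j k : 'I_4) (x1 x2 : 'I_2) (s : qstr) :
  (if (qb s 0 == x1) && (qb s 5 == x2) then
     (bell R j (qb s 1) (qb s 2))^* * (bell R k (qb s 3) (qb s 4))^* *
     psi_coef al (qb s 0) (qb s 1) * psi_coef ar (qb s 4) (qb s 5) else 0)
  = if s == mk_qstr x1 x1 (flip j x1) (flip k x2) x2 x2
    then (swap_coef j k x1 x2)%:C else 0.
Proof.
rewrite !bellE !psi_coefE !conjRC -!rmorphM.
case: (s =P _) => [->|ns].
  rewrite !qb_mk //= !eqxx /= flipK eqxx !mul1r; congr (_%:C).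
  have hh : (Num.sqrt 2)^-1 * (Num.sqrt 2)^-1 = 2^-1 :> R.
    by rewrite -invfM -expr2 sqr_sqrtr ?ler0n.
  by rewrite /swap_coef -hh; move: (Num.sqrt 2)^-1 => h; ring.
case: eqP => //= s0; case: eqP => //= s5.
case: (qb s 2 =P _) => [s2|]; last by rewrite !mul0r.
case: (qb s 4 =P _) => [s4|]; last by rewrite !(mul0r, mulr0).
case: (qb s 0 =P _) => [s1|]; last by rewrite !(mul0r, mulr0).
case: (qb s 4 =P qb s 5) => [s3|]; last by rewrite !(mul0r, mulr0).
case: ns; rewrite -[s]mk_qstrK.
have s4' : qb s 3 = flip k x2 by rewrite -s5 -s3 s4 flipK.
by rewrite s2 s4' s3 s5 -s1 s0.
Qed.

(** Swapping through the pure segments acts on [rho] by local bit flips and local diagonal filters,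
    since [swap_coef] is a product of a function of [x1] and one of [x2]. *)
Lemma cond_ABE (j k : 'I_4) x y : cond_AB al p delta ar j k x y =
  (swap_coef j k x.1 x.2)%:C * rho p delta (flip j x.1, flip k x.2)
    (flip j y.1, flip k y.2) * (swap_coef j k y.1 y.2)%:C.
Proof.
pose D (z : 'I_2 * 'I_2) (s : qstr) : C :=
  if s == mk_qstr z.1 z.1 (flip j z.1) (flip k z.2) z.2 z.2
  then (swap_coef j k z.1 z.2)%:C else 0.
transitivity (\sum_s \sum_t
  D x s * rho p delta (qb s 2, qb s 3) (qb t 2, qb t 3) * D y t).
  apply: eq_bigr => s _; apply: eq_bigr => t _; rewrite /D -!swap_delta /Omega.
  case: (qb s 0 == x.1); last by rewrite /= !mul0r.
  case: (qb s 5 == x.2); last by rewrite /= !mul0r.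
  case: (qb t 0 == y.1); last by rewrite /= !mulr0.
  case: (qb t 5 == y.2); last by rewrite /= !mulr0.
  by rewrite /= !bellE !psi_coefE !conjRC; ring.
rewrite (bigD1 (mk_qstr x.1 x.1 (flip j x.1) (flip k x.2) x.2 x.2)) //=.
rewrite [X in _ + X]big1 ?addr0; last first.
  by move=> s /negPf ns; rewrite big1 // => t _; rewrite /D ns !mul0r.
rewrite (bigD1 (mk_qstr y.1 y.1 (flip j y.1) (flip k y.2) y.2 y.2)) //=.
rewrite [X in _ + X]big1 ?addr0; last first.
  by move=> s /negPf ns; rewrite /D ns !mulr0.
by rewrite /D !eqxx !qb_mk.
Qed.

Definition swap_t (j k : 'I_4) : R :=
  p * swap_coef j k (flip j ord0) (flip k ord_max) ^+ 2.
Definition swap_u (j k : 'I_4) : R :=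
  u * swap_coef j k (flip j ord0) (flip k ord0).
Definition swap_v (j k : 'I_4) : R :=
  v * swap_coef j k (flip j ord_max) (flip k ord_max).

(** The flips carry |01> to |flip j 0, flip k 1>, the new reference state; the coherent pair is
    carried to its two neighbours at one bit flip. *)
Lemma cond_AB_fam (j k : 'I_4) : cond_AB al p delta ar j k =
  fam (flip j ord0) (flip k ord_max) (swap_t j k) (swap_u j k) (swap_v j k).
Proof.
apply: funext => -[x1 x2]; apply: funext => -[y1 y2].
rewrite cond_ABE rho_fam // /fam -!rmorphM; congr (_%:C); rewrite /= !flip_eq.
have I2 (a b : 'I_2) : (a == b) = false -> a = rev_ord b.
  by move=> ab; apply/eqP; rewrite eq_rev_ord2 ab.
have r0 : rev_ord (flip j ord0) = flip j ord_max by rewrite flip0 rev_ordK.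
have r1 : rev_ord (flip k ord_max) = flip k ord0 by rewrite flip0.
rewrite /famB /fam_vec /swap_t /swap_u /swap_v -/u -/v.
case E1: (x1 == flip j ord0);
  [move/eqP: E1 => -> | move/I2: E1 => ->; rewrite r0];
(case E2: (x2 == flip k ord_max);
  [move/eqP: E2 => -> | move/I2: E2 => ->; rewrite r1]);
(case E3: (y1 == flip j ord0);
  [move/eqP: E3 => -> | move/I2: E3 => ->; rewrite ?r0]);
(case E4: (y2 == flip k ord_max);
  [move/eqP: E4 => -> | move/I2: E4 => ->; rewrite ?r1]);
rewrite /=; ring.
Qed.

End Swap.
End Repeater.

(** * The four-party repeater *)

Section FourParties.
Variable R : realType.
Local Notation C := R[i].

Lemma lam_norm (al' : R) : 0 <= al' <= 1 ->
  \sum_x \sum_y ((x == y)%:R * lam al' x) ^+ 2 = 1.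
Proof.
move=> /andP[a0 a1]; rewrite !big_ord_recl !big_ord0 /lam /=.
by rewrite !mul0r !mul1r !expr0n !addr0 /= add0r !sqr_sqrtr ?subr_ge0 //; ring.
Qed.

(** Partial transposition across the cut A N1 | N2 B, which separates the qubits of the middle
    segment only. *)
Definition mix_qstr (s t : qstr) : qstr :=
  mk_qstr (qb s 0) (qb s 1) (qb s 2) (qb t 3) (qb t 4) (qb t 5).

Lemma loc4E m (s : qstr) (q : 'I_4) : val (loc4 m s q) = match val q with
  | 0%N => val (qb s 0) | 1%N => 2 * val (qb s 1) + val (qb s 2)
  | 2%N => 2 * val (qb s 3) + val (qb s 4) | _ => val (qb s 5) end%N.
Proof.
rewrite ffunE /= inordK // (@leq_trans 4) //.
have lt2 k : (qb s k < 2)%N by exact: ltn_ord.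
move: (lt2 0%N) (lt2 1%N) (lt2 2%N) (lt2 3%N) (lt2 4%N) (lt2 5%N).
case: q => [[|[|[|[|//]]]] ?] /=; lia.
Qed.

Lemma loc4_inj m : injective (@loc4 m).
Proof.
move=> s t /ffunP h.
have E (q : 'I_4) := congr1 val (h q); rewrite /= in E.
have lt2 s' k : (qb s' k < 2)%N by exact: ltn_ord.
have := E (@Ordinal 4 0 isT); have := E (@Ordinal 4 1 isT).
have := E (@Ordinal 4 2 isT); have := E (@Ordinal 4 3 isT).
rewrite !loc4E /= => e5 e34 e12 e0.
have e1 : qb s 1 = qb t 1.
  by apply: val_inj => /=; move: (lt2 s 1%N) (lt2 s 2%N) (lt2 t 1%N) (lt2 t 2%N); lia.
have e2 : qb s 2 = qb t 2.
  by apply: val_inj => /=; move: (lt2 s 1%N) (lt2 s 2%N) (lt2 t 1%N) (lt2 t 2%N); lia.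
have e3 : qb s 3 = qb t 3.
  by apply: val_inj => /=; move: (lt2 s 3%N) (lt2 s 4%N) (lt2 t 3%N) (lt2 t 4%N); lia.
have e4 : qb s 4 = qb t 4.
  by apply: val_inj => /=; move: (lt2 s 3%N) (lt2 s 4%N) (lt2 t 3%N) (lt2 t 4%N); lia.
by rewrite -[s]mk_qstrK -[t]mk_qstrK e1 e2 e3 e4 (val_inj e0) (val_inj e5).
Qed.

(** * The upper bound for the repeater *)

Section UpperBound4.
Variables (al p delta ar : R).
Hypothesis p01 : 0 < p < 1.
Hypothesis al01 : 0 <= al <= 1.
Hypothesis ar01 : 0 <= ar <= 1.
Let u := rho_u p delta.
Let v := rho_v p delta.

Lemma pval_embed4_le m (pi : protocol R 'I_4 m) : valid pi ->
  pval ord0 ord_max pi (embed4 al p delta ar) <= fam_value p u v.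
Proof.
case/andP: p01 => p0 p1 vpi; rewrite -fam_wit_norm //.
pose A (x y : 'I_2) := (x == y)%:R * lam al x.
pose B (x y : 'I_2) := (x == y)%:R * lam ar x.
pose V (k : 'I_3) (s : qstr) := (A (qb s 0) (qb s 1) *
  fam_wit p u v k (qb s 2 == ord0) (qb s 3 == ord_max) * B (qb s 4) (qb s 5))%:C.
pose w (s : qstr) := (A (qb s 0) (qb s 1) *
  fam_neg p u v (qb s 2 == ord0) (qb s 3 == ord_max) * B (qb s 4) (qb s 5))%:C.
have := @pval_Emb R 'I_4 qstr m (@loc4 m) [set q : 'I_4 | (q < 2)%N] ord0 ord_max
  mix_qstr pi (Omega al p delta ar) 3 V w.
have -> : \sum_k \sum_s sqnorm (V k s)
        = \sum_k sum4 (fun b1 b2 => fam_wit p u v k b1 b2 ^+ 2).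
  apply: eq_bigr => k _; under eq_bigr => s _ do rewrite sqnormR.
  rewrite (sum_qstr (fun q0 q1 q2 q3 q4 q5 => (A q0 q1 *
    fam_wit p u v k (q2 == ord0) (q3 == ord_max) * B q4 q5) ^+ 2)).
  (* The norms factor over the three segments, and the outer ones are normalized, so the bound is
     that of [rho] alone. *)
  transitivity ((\sum_q0 \sum_q1 A q0 q1 ^+ 2) *
    (\sum_(q2 : 'I_2) \sum_(q3 : 'I_2)
       fam_wit p u v k (q2 == ord0) (q3 == ord_max) ^+ 2) *
    (\sum_q4 \sum_q5 B q4 q5 ^+ 2)).
    rewrite !mulr_suml; apply: eq_bigr => q0 _.
    rewrite !mulr_suml; apply: eq_bigr => q1 _.
    rewrite [X in _ = X * _]mulr_sumr !mulr_suml; apply: eq_bigr => q2 _.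
    rewrite [X in _ = X * _]mulr_sumr !mulr_suml; apply: eq_bigr => q3 _.
    rewrite !mulr_sumr; apply: eq_bigr => q4 _.
    rewrite !mulr_sumr; apply: eq_bigr => q5 _.
    by rewrite !exprMn.
  rewrite !lam_norm // mul1r mulr1 pair_big /=.
  exact: (sum_agreement _ _ (fun b1 b2 => fam_wit p u v k b1 b2 ^+ 2)).
apply=> //.
- exact: loc4_inj.
- by rewrite inE.
- by rewrite inE.
- by move=> s t; rewrite /mix_qstr !qb_mk // mk_qstrK.
- move=> s t; apply/ffunP => q; apply: val_inj; rewrite [in RHS]ffunE inE.
  rewrite loc4E [RHS]fun_if !loc4E /mix_qstr !qb_mk //.
  by case: q => [[|[|[|[|//]]]] ?].
- move=> s t; rewrite /Omega rho_fam // /fam famB_wit // !psi_coefE /V /w /=.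
  rewrite /mix_qstr !qb_mk //= !big_ord_recl !big_ord0 !addr0 -/u -/v /A /B.
  rewrite !conjRC -!rmorphM -!rmorphD -rmorphB; congr (_%:C).
  by ring.
Qed.

End UpperBound4.

(* N1 and N2 store the pair of qubits (q, q') in basis vector 2 q + q'. *)
Definition hi (y : 'I_4) : 'I_2 := if (y < 2)%N then ord0 else ord_max.
Definition lo (y : 'I_4) : 'I_2 := if odd y then ord_max else ord0.

(** The Kraus operator |0><bell j|: resetting the node to a fixed basis vector puts the state in the
    form required by [fam_achievable]. With ancilla size 0 the local space is exactly two qubits. *)
Definition bellK (j : 'I_4) (x y : loc 0) : C :=
  (x == ord0)%:R * (bell R j (hi y) (lo y))^*.

(** The reset drops out of the adjoint product, which leaves completeness of the Bell basis. *)
Lemma tp_bellK : trace_preserving bellK.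
Proof.
move=> x y.
transitivity (\sum_(j < 4) bell R j (hi x) (lo x) * (bell R j (hi y) (lo y))^*).
  apply: eq_bigr => j _; rewrite (bigD1 ord0) //= [X in _ + X]big1 ?addr0.
    by rewrite /bellK eqxx !mul1r conjCK.
  by move=> z /negPf nz; rewrite /bellK nz !mul0r mulr0.
have hh : ((Num.sqrt 2)^-1%:C : C) * (Num.sqrt 2)^-1%:C = 2^-1.
  by rewrite -rmorphM -invfM -expr2 sqr_sqrtr ?ler0n //= fmorphV rmorph_nat.
have half : 2^-1 + 2^-1 = 1 :> C by rewrite -div1r -splitr.
rewrite !big_ord_recl big_ord0 /bell /hi /lo.
case: x y => [[|[|[|[|//]]]] ?] [[|[|[|[|//]]]] ?]; rewrite /= ?rmorph0 ?conjRC.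
all: rewrite ?rmorphN ?mulrNN ?mulrN ?mulNr ?hh.
all: by rewrite ?mul0r ?mulr0 ?oppr0 ?addr0 ?add0r ?subrr ?addNr ?half.
Qed.

Definition gl4 (x : 'I_2 * 'I_2) : glob 'I_4 0 := [ffun q : 'I_4 =>
  if q == ord0 then emb 0 x.1 else if q == ord_max then emb 0 x.2 else ord0].

Definition N1 : 'I_4 := @Ordinal 4 1 isT.
Definition N2 : 'I_4 := @Ordinal 4 2 isT.

Lemma conjugate_Emb (X P : finType) m (gl : X -> glob P m) W
    (M : gop R P m) g h :
  conjugate M (embed_op gl W) g h = \sum_x \sum_y M g (gl x) * W x y * (M h (gl y))^*.
Proof.
rewrite /conjugate.
transitivity (\sum_k \sum_l \sum_x \sum_y ((k == gl x) && (l == gl y))%:R *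
   (M g (gl x) * W x y * (M h (gl y))^*)).
  apply: eq_bigr => k _; apply: eq_bigr => l _.
  rewrite /embed_op mulr_sumr mulr_suml; apply: eq_bigr => x _.
  rewrite mulr_sumr mulr_suml; apply: eq_bigr => y _.
  case: (k =P gl x) => [->|]; last by rewrite !mul0r mulr0 mul0r.
  case: (l =P gl y) => [->|]; last by rewrite !mul0r mulr0 mul0r.
  by rewrite !mul1r.
under eq_bigr => k _ do rewrite exchange_big /=.
rewrite exchange_big; apply: eq_bigr => x _ /=.
under eq_bigr => k _ do rewrite exchange_big /=.
rewrite exchange_big; apply: eq_bigr => y _ /=.
rewrite (bigD1 (gl x)) //= [X in _ + X]big1 ?addr0; last first.
  by move=> k /negPf nk; rewrite big1 // => l _; rewrite nk mul0r.
rewrite (bigD1 (gl y)) //= [X in _ + X]big1 ?addr0 ?eqxx ?mul1r // => l /negPf nl.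
by rewrite nl andbF mul0r.
Qed.

Lemma bellK_loc4 (j k : 'I_4) (g : glob 'I_4 0) (s : qstr) :
  local_apply N1 (bellK j) (fun g => lift N2 (bellK k) g (loc4 0 s)) g
  = (g == gl4 (qb s 0, qb s 5))%:R *
    ((bell R j (qb s 1) (qb s 2))^* * (bell R k (qb s 3) (qb s 4))^*).
Proof.
have hl1 : hi (loc4 0 s N1) = qb s 1 /\ lo (loc4 0 s N1) = qb s 2.
  rewrite /hi /lo (loc4E _) /=.
  by case: (qb s 1) (qb s 2) => [[|[|//]] ?] [[|[|//]] ?]; split; apply: val_inj.
have hl2 : hi (loc4 0 s N2) = qb s 3 /\ lo (loc4 0 s N2) = qb s 4.
  rewrite /hi /lo (loc4E _) /=.
  by case: (qb s 3) (qb s 4) => [[|[|//]] ?] [[|[|//]] ?]; split; apply: val_inj.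
rewrite /local_apply (bigD1 (loc4 0 s N1)) //= [X in _ + X]big1 ?addr0; last first.
  move=> z /negPf nz; rewrite /lift; case: ifP; last by rewrite mulr0.
  by move=> /forallP/(_ N1); rewrite updE eqxx nz.
rewrite /bellK /lift (proj1 hl1) (proj2 hl1) (proj1 hl2) (proj2 hl2) updE /=.
(* Both nodes must have been reset, while A and B keep their bits. *)
have -> : (g == gl4 (qb s 0, qb s 5)) = [&& [forall q, (q != N2) ==>
    (upd g N1 (loc4 0 s N1) q == loc4 0 s q)], g N1 == ord0 & g N2 == ord0].
  have e0 : emb 0 (qb s 0) = loc4 0 s ord0 by rewrite [RHS]ffunE.
  have e5 : emb 0 (qb s 5) = loc4 0 s ord_max by rewrite [RHS]ffunE.
  apply/eqP/and3P => [->|[/forallP ag /eqP g1 /eqP g2]].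
    split; [|by rewrite ffunE|by rewrite ffunE]; apply/forallP => q; apply/implyP => nq.
    rewrite updE; case: (q =P N1) => [->//|/eqP nq1]; rewrite ffunE /= e0 e5.
    case: q nq nq1 => [[|[|[|[|//]]]] iq] //= _ _; apply/eqP; congr (loc4 0 s _).
      exact: val_inj.
    exact: val_inj.
  apply/ffunP => q; rewrite ffunE e0 e5; have := ag q; rewrite updE.
  case: (q =P N2) => [->//|sqnorm /= /eqP]; case: (q =P N1) => [->//|n1 ->].
  case: (q =P ord0) => [->//|n0]; case: (q =P ord_max) => [->//|n3].
  by case: q n0 n1 sqnorm n3 => [[|[|[|[|//]]]] iq] n0 n1 sqnorm n3;
    [case: n0|case: n1|case: sqnorm|case: n3]; apply: val_inj.
case: [forall q, _]; last by rewrite mulr0 mul0r.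
case: (g N1 == ord0); last by rewrite !mul0r.
by case: (g N2 == ord0); rewrite ?mul0r ?mulr0 ?mul1r.
Qed.

(** Identifies the two measurement rounds of an actual protocol with the explicit conditional
    operator [cond_AB]. *)
Lemma bell_measurements (al p delta ar : R) (j k : 'I_4) :
  conjugate (lift N1 (bellK j)) (conjugate (lift N2 (bellK k))
    (embed4 al p delta ar)) = embed_op gl4 (cond_AB al p delta ar j k).
Proof.
apply: funext => g; apply: funext => h; rewrite conjugateE.
have -> : embed4 al p delta ar = embed_op (@loc4 0) (Omega al p delta ar) by [].
transitivity (\sum_s \sum_t
   local_apply N1 (bellK j) (fun g => lift N2 (bellK k) g (loc4 0 s)) g *
   Omega al p delta ar s t *
   (local_apply N1 (bellK j) (fun g => lift N2 (bellK k) g (loc4 0 t)) h)^*).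
  under eq_bigr => z _.
    under eq_bigr => z' _.
      rewrite conjugate_Emb mulr_sumr mulr_suml.
      under eq_bigr => s _ do rewrite mulr_sumr mulr_suml.
      over.
    rewrite exchange_big; under eq_bigr => s _ do rewrite exchange_big.
    over.
  rewrite exchange_big; apply: eq_bigr => s _ /=.
  rewrite exchange_big; apply: eq_bigr => t _ /=.
  rewrite /local_apply !mulr_suml; apply: eq_bigr => z _.
  rewrite rmorph_sum mulr_sumr; apply: eq_bigr => z' _ /=.
  by rewrite [(bellK j (h N1) _ * _)^*]rmorphM /=; ring.
rewrite /embed_op /cond_AB.
under [RHS]eq_bigr => x _.
  under eq_bigr => y _.
    rewrite mulr_sumr; under eq_bigr => s _ do rewrite mulr_sumr.
    over.
  rewrite exchange_big; under eq_bigr => s _ do rewrite exchange_big.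
  over.
rewrite [RHS]exchange_big; apply: eq_bigr => s _ /=.
rewrite [RHS]exchange_big; apply: eq_bigr => t _ /=.
have pairE (z : 'I_2 * 'I_2) (w : qstr) :
    z != (qb w 0, qb w 5) -> (qb w 0 == z.1) && (qb w 5 == z.2) = false.
  by case: z => z1 z2; rewrite xpair_eqE [z1 == _]eq_sym [z2 == _]eq_sym => /negPf.
rewrite (bigD1 (qb s 0, qb s 5)) //= [X in _ + X]big1 ?addr0; last first.
  move=> x /pairE xs; rewrite big1 // => y _.
  by rewrite xs /= mulr0.
rewrite (bigD1 (qb t 0, qb t 5)) //= [X in _ + X]big1 ?addr0; last first.
  by move=> y /pairE yt; rewrite -andbA yt andbF mulr0.
rewrite !eqxx !bellK_loc4 !rmorphM rmorph_nat /= !conjCK.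
by rewrite -mulnb natrM; ring.
Qed.
End FourParties.

(** * Schmidt weights of the Bell outcomes and the hypothesis on them *)

Lemma lam_gt0 (R : realType) (a : R) x : 1 / 2 <= a < 1 -> 0 < lam a x.
Proof. by move=> ha; rewrite /lam; case: ifP => _; rewrite sqrtr_gt0; lra. Qed.

Lemma lam_ge0 (R : realType) (a : R) x : 0 <= lam a x.
Proof. by rewrite /lam; case: ifP => _; exact: sqrtr_ge0. Qed.

Lemma lam_sqr (R : realType) (a : R) x : 1 / 2 <= a < 1 ->
  lam a x ^+ 2 = if x == ord0 then a else 1 - a.
Proof. by move=> ha; rewrite /lam; case: ifP => _; rewrite sqr_sqrtr //; lra. Qed.

Lemma lam_bounds (R : realType) (a : R) x : 1 / 2 <= a < 1 ->
  (lam a ord_max <= lam a x) && (lam a x <= lam a ord0).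
Proof.
move=> ha; have le : lam a ord_max <= lam a ord0 by rewrite /lam /= ler_wsqrtr; lra.
have [->|->] : x = ord0 \/ x = ord_max.
  by case: x => [[|[|//]] ?]; [left|right]; apply: val_inj.
  by rewrite le lexx.
by rewrite le lexx.
Qed.

Section SwapWeights.
Variable R : realType.
Variables (p delta al ar : R).
Hypothesis p01 : 0 < p < 1.
Hypothesis delta01 : 1 / 2 <= delta < 1.
Hypothesis al01 : 1 / 2 <= al < 1.
Hypothesis ar01 : 1 / 2 <= ar < 1.
Let u := rho_u p delta.
Let v := rho_v p delta.

Lemma swap_coef_sqr j k x y :
  swap_coef al ar j k x y ^+ 2 = lam al x ^+ 2 * lam ar y ^+ 2 / 4.
Proof.
transitivity (bell_sign R j x ^+ 2 * bell_sign R k (flip k y) ^+ 2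
   * (lam al x ^+ 2 * lam ar y ^+ 2 / 4)); first by rewrite /swap_coef; field.
by rewrite !bell_sign2 !mul1r.
Qed.

Lemma swap_coef_norm j k x y :
  `|swap_coef al ar j k x y| = lam al x * lam ar y / 2.
Proof.
have l0 := lam_gt0 x al01; have m0 := lam_gt0 y ar01.
apply/eqP; rewrite -(@eqrXn2 _ 2) //; last by rewrite !mulr_ge0 ?invr_ge0 ?ltW.
by rewrite real_normK ?num_real // swap_coef_sqr; apply/eqP; field.
Qed.

Lemma swap_t_gt0 j k : 0 < swap_t al p ar j k.
Proof.
case/andP: p01 => p0 _.
rewrite /swap_t swap_coef_sqr !mulr_gt0 ?invr_gt0 ?exprn_gt0 ?lam_gt0 //; lra.
Qed.

(** In the last term of [fam_value] the weights cancel to a single product, so each of the four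
    terms carries one squared Schmidt coefficient per outer segment. By normalization each such
    product sums to 4 over the outcomes, which turns 1/8 into 1/2. *)
Lemma sum_swap_value :
  \sum_j \sum_k fam_value (swap_t al p ar j k) (swap_u al p delta ar j k)
                          (swap_v al p delta ar j k) = fam_value p u v.
Proof.
case/andP: p01 => p0 _.
pose L x := lam al x ^+ 2; pose M x := lam ar x ^+ 2.
have L0 x : L x != 0 by rewrite gt_eqF // exprn_gt0 // lam_gt0.
have M0 x : M x != 0 by rewrite gt_eqF // exprn_gt0 // lam_gt0.
transitivity (\sum_j \sum_k (p * (L (flip j ord0) * M (flip k ord_max))
  + u ^+ 2 * (L (flip j ord0) * M (flip k ord0))
  + v ^+ 2 * (L (flip j ord_max) * M (flip k ord_max))
  + (u * v) ^+ 2 / p * (L (flip j ord_max) * M (flip k ord0))) / 8).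
  apply: eq_bigr => j _; apply: eq_bigr => k _.
  have split_sqr c0 c1 c2 : fam_value (p * c0 ^+ 2) (u * c1) (v * c2) =
      (p * c0 ^+ 2 + u ^+ 2 * c1 ^+ 2 + v ^+ 2 * c2 ^+ 2
       + (u * v) ^+ 2 * (c1 ^+ 2 * c2 ^+ 2) / (p * c0 ^+ 2)) / 2.
    by rewrite /fam_value !exprMn; congr (_ / _); congr (_ + _ / _); ring.
  rewrite /swap_t /swap_u /swap_v -/u -/v split_sqr !swap_coef_sqr.
  rewrite -/(L _) -/(L _) -/(M _) -/(M _).
  by field; rewrite L0 M0 gt_eqF.
rewrite !big_ord_recl !big_ord0 /L /M !lam_sqr // /flip /= /fam_value.
by field; rewrite gt_eqF.
Qed.

Hypothesis balance : (al * ar) / ((1 - al) * (1 - ar))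
    <= p ^+ 2 / (delta * (1 - delta) * (1 - p) ^+ 2).

Lemma coherence_ge0 : 0 <= u * v.
Proof. by rewrite /u /v /rho_u /rho_v !mulr_ge0 ?sqrtr_ge0. Qed.

(** The square root of the hypothesis [balance] with denominators cleared; since both sides are
    nonnegative, it is proved by squaring. *)
Lemma coherence_le :
  u * v * (lam al ord0 * lam ar ord0) <= p * (lam al ord_max * lam ar ord_max).
Proof.
case/andP: p01 => p0 p1; case/andP: delta01 => d0 d1.
case/andP: al01 => al0 al1; case/andP: ar01 => ar0 ar1.
rewrite -(@ler_pXn2r _ 2) ?nnegrE //; last 2 first.
- by rewrite mulr_ge0 ?coherence_ge0 // mulr_ge0 ?ltW ?lam_gt0.
- by rewrite mulr_ge0 ?(ltW p0) // mulr_ge0 ?ltW ?lam_gt0.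
rewrite !exprMn !lam_sqr //= ?/u /v /rho_u /rho_v ?exprMn.
rewrite !sqr_sqrtr; try lra.
have D0 : 0 < delta * (1 - delta) * (1 - p) ^+ 2.
  by rewrite !mulr_gt0 ?exprn_gt0; lra.
have E0 : 0 < (1 - al) * (1 - ar) by rewrite mulr_gt0; lra.
move: balance; rewrite ler_pdivrMr // [X in _ <= X -> _]mulrAC ler_pdivlMr // => le.
by apply: le_trans (le_trans le _); rewrite le_eqVlt; apply/orP; left; apply/eqP; ring.
Qed.

(** After removal of the common factor [l1 m2 / 4], an outcome compares [l2 m1] with [l1 m2]. The
    worst case has the largest product on the left and the smallest on the right, which is
    [coherence_le]. *)
Lemma swap_coherence_le j k :
  `|swap_u al p delta ar j k * swap_v al p delta ar j k| <= swap_t al p ar j k.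
Proof.
rewrite /swap_u /swap_v /swap_t -/u -/v mulrACA normrM (ger0_norm coherence_ge0).
rewrite normrM !swap_coef_norm swap_coef_sqr.
set l1 := lam al (flip j ord0); set l2 := lam al (flip j ord_max).
set m1 := lam ar (flip k ord0); set m2 := lam ar (flip k ord_max).
have l1_gt0 : 0 < l1 by exact: lam_gt0.
have m2_gt0 : 0 < m2 by exact: lam_gt0.
have lm : l2 * m1 <= lam al ord0 * lam ar ord0.
  have /andP[_ hl] := lam_bounds (flip j ord_max) al01.
  have /andP[_ hm] := lam_bounds (flip k ord0) ar01.
  by apply: ler_pM => //; exact: lam_ge0.
have lm' : lam al ord_max * lam ar ord_max <= l1 * m2.
  have /andP[hl _] := lam_bounds (flip j ord0) al01.
  have /andP[hm _] := lam_bounds (flip k ord_max) ar01.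
  by apply: ler_pM => //; exact: lam_ge0.
have le : u * v * (l2 * m1) <= p * (l1 * m2).
  case/andP: p01 => p0 _.
  apply: le_trans (ler_wpM2l coherence_ge0 lm) _.
  by apply: le_trans coherence_le _; rewrite ler_pM2l.
have -> : u * v * (l1 * m1 / 2 * (l2 * m2 / 2)) = l1 * m2 / 4 * (u * v * (l2 * m1)).
  by field.
have -> : p * (l1 ^+ 2 * m2 ^+ 2 / 4) = l1 * m2 / 4 * (p * (l1 * m2)) by field.
by rewrite ler_pM2l // !mulr_gt0 ?invr_gt0 ?ltr0n.
Qed.

(** The Schmidt product at [ord_max] is at most that at [ord0], so dividing [coherence_le] by the
    latter gives the bound. *)
Lemma rho_coherence_le : `|u * v| <= p.
Proof.
rewrite ger0_norm ?coherence_ge0 //; case/andP: p01 => p0 _.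
have lm0 : 0 < lam al ord0 * lam ar ord0 by rewrite mulr_gt0 ?lam_gt0.
rewrite -(ler_pM2r lm0); apply: le_trans coherence_le _; rewrite ler_pM2l //.
have /andP[_ hl] := lam_bounds ord_max al01.
have /andP[_ hm] := lam_bounds ord_max ar01.
by apply: ler_pM => //; exact: lam_ge0.
Qed.

Lemma FstarAB_value : FstarAB al p delta ar = fam_value p u v.
Proof.
case/andP: (p01) => p0 p1; case/andP: (al01) => al0 al1; case/andP: (ar01) => ar0 ar1.
have ub : ubound [set w | exists (m : nat) (pi : protocol R 'I_4 m),
    valid pi /\ w = pval ord0 ord_max pi (embed4 (m:=m) al p delta ar)]%classic
    (fam_value p u v).
  by move=> _ [m [pi [vpi ->]]]; apply: pval_embed4_le => //; lra.
apply/eqP; rewrite eq_le; apply/andP; split.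
  by apply: ge_sup => //; eexists; exists 0%N, (PStop R _ _).
(* An optimal continuation is fixed for each pair of Bell outcomes, to be run once both are
   announced. *)
have /choice[pi pi_opt] (jk : 'I_4 * 'I_4) : exists pi : protocol R 'I_4 0,
    valid pi /\ fam_value (swap_t al p ar jk.1 jk.2)
      (swap_u al p delta ar jk.1 jk.2) (swap_v al p delta ar jk.1 jk.2)
    <= pval ord0 ord_max pi (embed_op gl4 (cond_AB al p delta ar jk.1 jk.2)).
  case: jk => j k /=; rewrite cond_AB_fam //.
  have [|||pi vpi le_pi] := @fam_achievable R 'I_4 0 ord0 ord_max gl4 _ _ _
    (flip j ord0) (flip k ord_max) _ _ _ (swap_t_gt0 j k) (swap_coherence_le j k).
  - by move=> x; rewrite ffunE.
  - by move=> x; rewrite ffunE.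
  - by move=> x y q /negPf q0 /negPf q3; rewrite !ffunE q0 q3.
  by exists pi.
(* N2 measures first, so its outcome [k] has to be the outer summation index. *)
rewrite -sum_swap_value exchange_big.
apply: (@le_trans _ _ (pval ord0 ord_max
  (PRound N2 (@bellK R) (fun k => PRound N1 (@bellK R) (fun j => pi (j, k))))
  (embed4 al p delta ar))).
  rewrite /=; apply: ler_sum => k _; apply: ler_sum => j _.
  by rewrite bell_measurements; have [_] := pi_opt (j, k).
apply: ub_le_sup; first by exists (fam_value p u v).
exists 0%N; eexists; split; last reflexivity.
split; first exact: tp_bellK.
move=> k; split; first exact: tp_bellK.
by move=> j; have [] := pi_opt (j, k).
Qed.

Lemma bell_swap_valueE : bell_swap_value al p delta ar = fam_value p u v.
Proof.
case/andP: (p01) => p0 p1.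
rewrite -sum_swap_value; apply: eq_bigr => j _; apply: eq_bigr => k _.
rewrite cond_AB_fam //; apply: weighted_Fstar_fam; first exact: swap_t_gt0.
exact: swap_coherence_le.
Qed.

End SwapWeights.

Theorem theorem2 (R : realType) (p delta al ar : R) :
  0 < p < 1 ->
  1 / 2 <= delta < 1 ->
  1 / 2 <= al < 1 ->
  1 / 2 <= ar < 1 ->
  (al * ar) / ((1 - al) * (1 - ar))
    <= p ^+ 2 / (delta * (1 - delta) * (1 - p) ^+ 2) ->
  bell_swap_value al p delta ar = Fstar (rho p delta) /\
  FstarAB al p delta ar = Fstar (rho p delta).
Proof.
move=> p01 d01 al01 ar01 bal; case/andP: (p01) => p0 p1.
(* The hypothesis forces [|u v| <= p], so [Fstar (rho p delta)] is [fam_value], which is also the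
   value of both repeater quantities. *)
rewrite rho_fam // Fstar_fam //; last exact: (rho_coherence_le p01 d01 al01 ar01 bal).
by split; [exact: bell_swap_valueE | exact: FstarAB_value].
Qed.
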